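(* There is no weakly supercyclic tuple $(T_1,\dots,T_n)$, $n\in\mathbb{N}$, of (commuting) continuous linear operators on $L^1[0,1]$ such that each $T_j$ commutes with the Volterra operator $V$, $Vf(x)=\int_0^x f(t)\,dt$.
   Context: $\mathbb{K}$ is either $\mathbb{R}$ or $\mathbb{C}$ and all spaces are over $\mathbb{K}$. A tuple $(T_1,\dots,T_n)$ of commuting continuous linear operators on a topological vector space $X$ is supercyclic if there is $x\in X$ such that $\{wTx: w\in\mathbb{K},\ T\in\mathcal{F}\}$ is dense in $X$, where $\mathcal{F}$ is the semigroup generated by $T_1,\dots,T_n$. A tuple of operators on a Banach space $X$ is weakly supercyclic if it is supercyclic on $X$ carrying the weak topology. *)

(* Defs.v *)
From HB Require Import structures.
From mathcomp Require Import all_boot all_order all_algebra.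
From mathcomp Require Import all_classical all_reals all_analysis.
From mathcomp Require Import measurable_realfun.
From mathcomp Require Import complex.

Set Implicit Arguments.
Unset Strict Implicit.
Unset Printing Implicit Defensive.

Import Order.TTheory GRing.Theory Num.Theory.
Import numFieldNormedType.Exports.

Local Open Scope classical_set_scope.
Local Open Scope ring_scope.
Local Open Scope quotient_scope.

(* [scalar R k] is the field K, either the real or the complex numbers. *)
Inductive scalar_kind := RealScalars | ComplexScalars.

Definition scalar (R : realType) (k : scalar_kind) : numFieldType :=
  match k with RealScalars => R | ComplexScalars => R[i] end.

Section Scalars.
Context {R : realType} {k : scalar_kind}.
Local Notation K := (scalar R k).

Definition re : K -> R :=
  match k return scalar R k -> R with
  | RealScalars => id
  | ComplexScalars => @complex.Re R
  end.

Definition im : K -> R :=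
  match k return scalar R k -> R with
  | RealScalars => fun=> 0
  | ComplexScalars => @complex.Im R
  end.

(* [a + i b], with [b] ignored over the reals *)
Definition mk_scalar (a b : R) : K :=
  match k return scalar R k with
  | RealScalars => a
  | ComplexScalars => Complex a b
  end.

(* The norm of a [numFieldType] takes values in the field itself; [modulus] is
   its [R]-valued version. *)
Definition modulus (x : K) : R := re `|x|.

Definition of_real (a : R) : K := mk_scalar a 0.

End Scalars.

Section ScalarTheory.
Context {R : realType} {k : scalar_kind}.
Local Notation K := (scalar R k).
Implicit Types (x y : K) (a b : R).

Lemma re0 : re (0 : K) = 0. Proof. by case: k. Qed.

Lemma im0 : im (0 : K) = 0. Proof. by case: k. Qed.

Lemma reD x y : re (x + y) = re x + re y.
Proof. by case: k x y => //= -[? ?] [? ?]. Qed.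

Lemma imD x y : im (x + y) = im x + im y.
Proof. by case: k x y => [x y|[? ?] [? ?]] //=; rewrite addr0. Qed.

Lemma reM x y : re (x * y) = re x * re y - im x * im y.
Proof. by case: k x y => [x y|[? ?] [? ?]] //=; rewrite mul0r subr0. Qed.

Lemma imM x y : im (x * y) = re x * im y + im x * re y.
Proof. by case: k x y => [x y|[? ?] [? ?]] //=; rewrite mulr0 mul0r addr0. Qed.

Lemma re_mk a b : re (mk_scalar a b : K) = a. Proof. by case: k. Qed.

Lemma scalarE x : x = mk_scalar (re x) (im x).
Proof. by case: k x => // -[]. Qed.

Lemma modulusE x : modulus x = Num.sqrt (re x ^+ 2 + im x ^+ 2).
Proof.
rewrite /modulus; case: k x => [x|[a b]] //=.
by rewrite expr0n addr0 sqrtr_sqr.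
Qed.

Lemma of_real_modulus x : of_real (modulus x) = `|x|.
Proof. by rewrite /modulus; case: k x => [x|[a b]]. Qed.

Lemma of_realD a b : of_real (a + b) = of_real a + of_real b :> K.
Proof.
rewrite /of_real; case: k => //=.
by apply/eqP; rewrite eq_complex /= addr0 !eqxx.
Qed.

Lemma of_realM a b : of_real (a * b) = of_real a * of_real b :> K.
Proof.
rewrite /of_real; case: k => //=.
by apply/eqP; rewrite eq_complex /= !mulr0 !mul0r subr0 addr0 !eqxx.
Qed.

Lemma of_real0 : of_real 0 = 0 :> K.
Proof. by rewrite /of_real; case: k. Qed.

Lemma of_real_le a b : ((of_real a : K) <= of_real b) = (a <= b).
Proof. by rewrite /of_real; case: k => //=; rewrite lecE /= eqxx. Qed.

Lemma of_real_inj : injective (of_real : R -> K).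
Proof. by rewrite /of_real; case: k => // a b []. Qed.

Lemma modulus_ge0 x : 0 <= modulus x.
Proof. by rewrite modulusE sqrtr_ge0. Qed.

Lemma modulusD x y : modulus (x + y) <= modulus x + modulus y.
Proof.
by rewrite -of_real_le of_realD !of_real_modulus ler_normD.
Qed.

Lemma modulusM x y : modulus (x * y) = modulus x * modulus y.
Proof. by apply: of_real_inj; rewrite of_realM !of_real_modulus normrM. Qed.

Lemma modulus0 : modulus (0 : K) = 0.
Proof. by rewrite modulusE re0 im0 expr0n addr0 sqrtr0. Qed.

Lemma modulus_eq0 x : modulus x = 0 -> x = 0.
Proof.
move=> x0; apply/eqP; rewrite -normr_eq0 -of_real_modulus x0 /of_real.
by case: k x x0 => //= *; rewrite eqxx.
Qed.

Lemma re_le_modulus x : `|re x| <= modulus x.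
Proof. by rewrite modulusE -sqrtr_sqr ler_wsqrtr// lerDl sqr_ge0. Qed.

Lemma im_le_modulus x : `|im x| <= modulus x.
Proof. by rewrite modulusE -sqrtr_sqr ler_wsqrtr// lerDr sqr_ge0. Qed.

Lemma modulus_le x : modulus x <= `|re x| + `|im x|.
Proof.
rewrite modulusE -[leRHS]ger0_norm ?addr_ge0// -sqrtr_sqr ler_wsqrtr//.
rewrite sqrrD !real_normK ?num_real// [leRHS]addrAC lerDl.
by rewrite mulrn_wge0// mulr_ge0.
Qed.

End ScalarTheory.

Section L1.
Context d (T : measurableType d) (R : realType) (k : scalar_kind).
Variable mu : {measure set T -> \bar R}.
Local Notation K := (scalar R k).

Definition L1_pred : {pred T -> K^o} := mem [set f : T -> K^o |
  [/\ measurable_fun setT (fun x => re (f x)),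
      measurable_fun setT (fun x => im (f x)) &
      mu.-integrable setT (fun x => (modulus (f x))%:E)]].

Lemma L1_predP (f : T -> K^o) : f \in L1_pred <->
  mu.-integrable setT (fun x => (re (f x))%:E) /\
  mu.-integrable setT (fun x => (im (f x))%:E).
Proof.
split.
- rewrite inE => -[mr mi intf]; split.
  + apply: le_integrable intf => //; first exact/measurable_EFinP.
    move=> x _ /=; rewrite lee_fin (ger0_norm (modulus_ge0 _)).
    exact: re_le_modulus.
  + apply: le_integrable intf => //; first exact/measurable_EFinP.
    move=> x _ /=; rewrite lee_fin (ger0_norm (modulus_ge0 _)).
    exact: im_le_modulus.
- move=> [ir ii]; rewrite inE /=.
  have mr : measurable_fun setT (fun x => re (f x)).
    by apply/measurable_EFinP; case/integrableP : ir.
  have mi : measurable_fun setT (fun x => im (f x)).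
    by apply/measurable_EFinP; case/integrableP : ii.
  split=> //.
  have int2 := integrableD measurableT (integrable_abse ir) (integrable_abse ii).
  apply: le_integrable int2 => //.
    apply/measurable_EFinP.
    rewrite (_ : (fun x => _) = Num.sqrt \o
        (fun x => re (f x) ^+ 2 + im (f x) ^+ 2)); last first.
      by apply/funext => x /=; rewrite modulusE.
    apply: measurableT_comp => //.
      apply: continuous_measurable_fun; exact: sqrt_continuous.
    by apply: measurable_funD; apply: measurable_funX.
  move=> x _ /=; rewrite lee_fin (ger0_norm (modulus_ge0 _)).
  by rewrite ger0_norm ?addr_ge0// modulus_le.
Qed.

Lemma L1_pred_submod_closed : submod_closed L1_pred.
Proof.
split.
  apply/L1_predP; split.
  - by under eq_fun do rewrite re0; exact: integrable0.
  - by under eq_fun do rewrite im0; exact: integrable0.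
move=> a f g /L1_predP[fr fi] /L1_predP[gr gi]; apply/L1_predP; split.
- rewrite (_ : (fun x => _) = ((fun x => (re a)%:E * (re (f x))%:E) \-
     (fun x => (im a)%:E * (im (f x))%:E) \+ (fun x => (re (g x))%:E))%E).
    apply: integrableD => //; apply: integrableB => //; exact: integrableZl.
  by apply/funext => x /=; rewrite reD reM.
- rewrite (_ : (fun x => _) = ((fun x => (re a)%:E * (im (f x))%:E) \+
     (fun x => (im a)%:E * (re (f x))%:E) \+ (fun x => (im (g x))%:E))%E).
    apply: integrableD => //; apply: integrableD => //; exact: integrableZl.
  by apply/funext => x /=; rewrite imD imM.
Qed.

HB.instance Definition _ :=
  GRing.isSubmodClosed.Build _ _ L1_pred L1_pred_submod_closed.

Record L1fun := MkL1fun { L1fun_val :> T -> K^o ; _ : L1fun_val \in L1_pred }.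

HB.instance Definition _ := [isSub for L1fun_val].
HB.instance Definition _ := [Choice of L1fun by <:].
HB.instance Definition _ := [SubChoice_isSubLmodule of L1fun by <:].

Lemma L1funP (f : L1fun) : (f : T -> K^o) \in L1_pred.
Proof. exact: valP. Qed.

Definition ae0 : {pred L1fun} :=
  mem [set f : L1fun | {ae mu, forall x, f x = 0}].

Lemma ae0_submod_closed : submod_closed ae0.
Proof.
split; first by rewrite inE /=; apply: aeW.
move=> a f g; rewrite !inE /= => f0 g0.
apply: filterS2 f0 g0 => x fx gx.
by rewrite -[LHS]/(a * f x + g x) fx gx mulr0 addr0.
Qed.

HB.instance Definition _ :=
  GRing.isSubmodClosed.Build _ _ ae0 ae0_submod_closed.

Definition L1 : Type := Quotient.quot ae0.
HB.instance Definition _ := GRing.Zmodule.on L1.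
HB.instance Definition _ := EqQuotient.on L1.

End L1.

Section L1Theory.
Context d (T : measurableType d) (R : realType) (k : scalar_kind).
Variable mu : {measure set T -> \bar R}.
Local Notation K := (scalar R k).
Local Notation L1fun := (L1fun k mu).
Local Notation L1 := (L1 k mu).

Lemma L1_piE (f g : L1fun) :
  \pi_L1 f = \pi_L1 g <-> {ae mu, forall x, f x = g x}.
Proof.
rewrite (rwP eqP) -[_ == _]/(_ == _ %[mod Quotient.quot (@ae0 _ _ _ k mu)]).
rewrite -Quotient.idealrBE inE /=; split; apply: filterS => x /=.
  by move=> /eqP; rewrite -[X in X == _]/(f x - g x) subr_eq0 => /eqP.
by move=> fg; rewrite -[LHS]/(f x - g x) fg subrr.
Qed.

Lemma L1_reprE (f : L1fun) : {ae mu, forall x, repr (\pi_L1 f) x = f x}.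
Proof. by apply/L1_piE; rewrite reprK. Qed.

Definition L1_scale (a : K) (u : L1) : L1 := \pi_L1 (a *: repr u).

Lemma L1_pi_scale a (f : L1fun) : L1_scale a (\pi_L1 f) = \pi_L1 (a *: f).
Proof.
apply/L1_piE; apply: filterS (L1_reprE f) => x fx.
exact: (congr1 ( *%R a) fx).
Qed.

Lemma L1_pi_add (f g : L1fun) : \pi_L1 (f + g) = \pi_L1 f + \pi_L1 g.
Proof. exact: (@pi_addr _ _ _ _ _ (Quotient.quot (@ae0 _ _ _ k mu))). Qed.

Fact L1_scaleA a b u : L1_scale a (L1_scale b u) = L1_scale (a * b) u.
Proof.
by rewrite -[u]reprK (L1_pi_scale b) (L1_pi_scale a) (L1_pi_scale (a * b))
  scalerA.
Qed.

Fact L1_scale1 : left_id 1 L1_scale.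
Proof. by move=> u; rewrite -[u]reprK L1_pi_scale scale1r. Qed.

Fact L1_scaleDr : right_distributive L1_scale +%R.
Proof.
move=> a u v; rewrite -[u]reprK -[v]reprK.
by rewrite -L1_pi_add !L1_pi_scale -L1_pi_add scalerDr.
Qed.

Fact L1_scaleDl u : {morph L1_scale^~ u : a b / a + b}.
Proof.
by move=> a b; rewrite -[u]reprK !L1_pi_scale -L1_pi_add scalerDl.
Qed.

HB.instance Definition _ := GRing.Zmodule_isLmodule.Build K L1
  L1_scaleA L1_scale1 L1_scaleDr L1_scaleDl.

Definition L1_seminorm (f : L1fun) : R := \int[mu]_x modulus (f x).

Lemma L1fun_integrable (f : L1fun) :
  mu.-integrable setT (fun x => (modulus (f x))%:E).
Proof. by have := L1funP f; rewrite inE => -[]. Qed.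

Lemma L1_seminormE (f g : L1fun) :
  {ae mu, forall x, f x = g x} -> L1_seminorm f = L1_seminorm g.
Proof.
move=> fg; congr fine; apply: ae_eq_integral => //.
- by case/integrableP: (L1fun_integrable f).
- by case/integrableP: (L1fun_integrable g).
- by apply: filterS fg => x -> _.
Qed.

(* valued in [K] because the norm of a [normedModType K] is *)
Definition L1_norm (u : L1) : K := of_real (L1_seminorm (repr u)).

Lemma L1_norm_pi (f : L1fun) : L1_norm (\pi_L1 f) = of_real (L1_seminorm f).
Proof. by congr of_real; apply: L1_seminormE; exact: L1_reprE. Qed.

Lemma L1_ler_normD u v : L1_norm (u + v) <= L1_norm u + L1_norm v.
Proof.
rewrite -[u]reprK -[v]reprK -L1_pi_add !L1_norm_pi -of_realD of_real_le.
rewrite /L1_seminorm -RintegralD//; [|exact: L1fun_integrable..].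
apply: le_Rintegral => //; first exact: L1fun_integrable.
  exact: (integrableD measurableT (L1fun_integrable _) (L1fun_integrable _)).
by move=> x _; exact: modulusD.
Qed.

Lemma L1_normrZ a u : L1_norm (a *: u) = `|a| * L1_norm u.
Proof.
rewrite -[u]reprK -[_ *: _]/(L1_scale _ _) L1_pi_scale !L1_norm_pi.
rewrite -of_real_modulus -of_realM; congr of_real.
rewrite /L1_seminorm -RintegralZl//; last exact: L1fun_integrable.
by apply: eq_Rintegral => x _; rewrite -modulusM.
Qed.

Lemma L1_normr0_eq0 u : L1_norm u = 0 -> u = 0.
Proof.
rewrite -[u]reprK L1_norm_pi => H.
have {H} := of_real_inj (etrans H (esym (of_real0))).
set f := repr u => f0.
have -> : 0 = \pi_L1 0 by rewrite piE.
apply/L1_piE.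
have intf := L1fun_integrable f.
have mf : measurable_fun setT (fun x => (modulus (f x))%:E).
  by case/integrableP: intf.
have : (\int[mu]_x `|(modulus (f x))%:E| = 0)%E.
  under eq_integral do rewrite gee0_abs ?lee_fin ?modulus_ge0//.
  by rewrite -[LHS]fineK ?integrable_fin_num//; congr EFin.
move/(ae_eq_integral_abs mu measurableT mf); apply: filterS => x /(_ I) [].
by move/modulus_eq0.
Qed.

HB.instance Definition _ :=
  Lmodule_isNormed.Build K L1 L1_ler_normD L1_normrZ L1_normr0_eq0.

End L1Theory.

Section WeakTopology.
Context (K : numFieldType) (X : normedModType K).

Definition dual := {phi : {linear X -> K^o} | continuous phi}.

(* The weak topology is the coarsest one making every element of [dual]
   continuous, i.e., the one induced by the embedding of [X] in the product
   [{ptws dual -> K^o}]. *)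
Definition dual_eval (x : X) : {ptws dual -> K^o} := fun phi => sval phi x.

Definition weak : Type := initial_topology dual_eval.

HB.instance Definition _ := GRing.Lmodule.copy weak X.
HB.instance Definition _ := Topological.copy weak (initial_topology dual_eval).

Lemma weak_cvg (F : set_system weak) {FF : Filter F} (x : weak) :
  (forall phi : dual, sval phi y @[y --> F] --> sval phi x) -> F --> x.
Proof.
move=> Fx.
have FE : dual_eval @ F --> dual_eval x.
  apply/cvg_sup => phi A [B [[C oC <-] Cx] sBA].
  by apply: filterS sBA _; apply: Fx; exact: open_nbhs_nbhs.
move=> A [B [[C oC <-] Cx] sBA].
by apply: filterS sBA _; apply: FE; exact: open_nbhs_nbhs.
Qed.

Lemma weak_continuous (phi : dual) : continuous (sval phi : weak -> K^o).
Proof.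
move=> x A; rewrite nbhsE => -[B [oB Bx] sBA].
have : nbhs (dual_eval x) [set f : {ptws dual -> K^o} | B (f phi)].
  have /cvg_sup/(_ phi) := @cvg_id _ (nbhs (dual_eval x)).
  move=> /(_ [set f | B (f phi)]); apply.
  by exists [set f | B (f phi)]; split=> //; exists B.
rewrite nbhsE => -[C [oC Cx] sCB]; exists (dual_eval @^-1` C); split=> //.
  by exists C.
by move=> y /= /sCB; exact: sBA.
Qed.

Lemma weak_add_continuous : continuous (fun z : weak * weak => z.1 + z.2).
Proof.
move=> z; apply: weak_cvg => phi.
rewrite [X in X --> _](_ : _ =
    (fun t : weak * weak => sval phi t.1 + sval phi t.2) @ z); last first.
  by congr (_ @ z); apply/funext => t; exact: (linearD (sval phi)).
rewrite [X in _ --> X](_ : _ = sval phi z.1 + sval phi z.2); last first.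
  exact: (linearD (sval phi)).
apply: cvgD.
- apply: (@cvg_comp _ _ _ fst (sval phi : weak -> K^o) _ (nbhs z.1));
    first exact: cvg_fst.
  exact: weak_continuous.
- apply: (@cvg_comp _ _ _ snd (sval phi : weak -> K^o) _ (nbhs z.2));
    first exact: cvg_snd.
  exact: weak_continuous.
Qed.

Lemma weak_scale_continuous : continuous (fun z : K^o * weak => z.1 *: z.2).
Proof.
move=> z; apply: weak_cvg => phi.
rewrite [X in X --> _](_ : _ =
    (fun t : K^o * weak => t.1 *: sval phi t.2) @ z); last first.
  by congr (_ @ z); apply/funext => t; exact: (linearZZ (sval phi)).
rewrite [X in _ --> X](_ : _ = z.1 *: sval phi z.2); last first.
  exact: (linearZZ (sval phi)).
apply: cvgZ; first exact: cvg_fst.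
apply: (@cvg_comp _ _ _ snd (sval phi : weak -> K^o) _ (nbhs z.2));
  first exact: cvg_snd.
exact: weak_continuous.
Qed.

HB.instance Definition _ :=
  PreTopologicalNmodule_isTopologicalNmodule.Build weak weak_add_continuous.
HB.instance Definition _ :=
  TopologicalNmodule_isTopologicalLmodule.Build K weak weak_scale_continuous.

End WeakTopology.

(* the set of all non-empty products of the [T i] *)
Definition generated_semigroup (X : Type) (n : nat) (T : 'I_n -> X -> X) :
    set (X -> X) :=
  smallest [set F : set (X -> X) | forall f g, F f -> F g -> F (f \o g)]
    (range T).

Definition supercyclic (K : numFieldType) (X : topologicalLmodType K) (n : nat)
    (T : 'I_n -> X -> X) : Prop :=
  exists x : X,
    dense [set w *: S x | w in [set: K] & S in generated_semigroup T].

Definition weakly_supercyclic (K : numFieldType) (X : normedModType K)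
    (n : nat) (T : 'I_n -> X -> X) : Prop :=
  @supercyclic K (weak X) n T.

Section Volterra.
Context (R : realType) (k : scalar_kind).
Local Notation K := (scalar R k).

(* Functions on [0, 1] are represented by functions on the whole real line;
   their values outside [0, 1] are irrelevant, as [leb01] ignores them. *)
Definition leb01 : {measure set (measurableTypeR R) -> \bar R} :=
  mrestr (@lebesgue_measure R) (measurable_itv `[0%R : R, 1%R]).

Lemma leb01_lty : (leb01 setT < +oo)%E.
Proof.
rewrite /leb01 /= /mrestr setTI lebesgue_measure_itv /= lte_fin ltr01.
by rewrite oppr0 adde0 ltry.
Qed.

Local Notation L1_01 := (L1 k leb01).

Lemma ge0_primitive_measurable (h : R -> R) : (forall t, 0 <= h t) ->
  leb01.-integrable setT (fun t => (h t)%:E) ->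
  measurable_fun setT (fun x : R => \int[leb01]_(t in `[0, x]) h t).
Proof.
move=> h0 ih; apply: nondecreasing_measurable => // x y xy.
have ihD (D : set R) : measurable D -> leb01.-integrable D (fun t => (h t)%:E).
  by move=> mD; apply: integrableS ih.
apply: fine_le.
- by apply: integrable_fin_num => //; exact: ihD.
- by apply: integrable_fin_num => //; exact: ihD.
- apply: ge0_subset_integral => //.
  + by case/integrableP: (ihD _ (measurable_itv `[0, y])).
  + by move=> t _; rewrite lee_fin.
  + by move=> t /=; rewrite !in_itv /= => /andP[-> /le_trans]; apply.
Qed.

Lemma primitive_integrable (h : R -> R) :
  leb01.-integrable setT (fun t => (h t)%:E) ->
  leb01.-integrable setT (fun x => (\int[leb01]_(t in `[0, x]) h t)%:E).
Proof.
move=> ih.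
have ia : leb01.-integrable setT (fun t => `|h t|%:E) by exact: (integrable_abse ih).
have iS : leb01.-integrable setT (fun t => (`|h t| + h t)%:E).
  exact: (integrableD measurableT ia ih).
have iD (g : R -> R) (D : set R) : measurable D ->
    leb01.-integrable setT (fun t => (g t)%:E) ->
    leb01.-integrable D (fun t => (g t)%:E).
  by move=> mD; apply: integrableS.
have mF : measurable_fun setT (fun x : R => \int[leb01]_(t in `[0, x]) h t).
  rewrite (_ : (fun x => _) = (fun x => \int[leb01]_(t in `[0, x]) (`|h t| + h t))
      \- (fun x => \int[leb01]_(t in `[0, x]) `|h t|)).
    apply: measurable_funB; apply: ge0_primitive_measurable => // t.
    by rewrite addrC -lerBlDr sub0r lerNl -normrN ler_norm.
  apply/funext => x /=; rewrite -RintegralB//; try exact: iD.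
  by apply: eq_Rintegral => t _; rewrite addrAC subrr add0r.
pose M := \int[leb01]_t `|h t|.
apply: (@le_integrable _ _ _ _ _ _ _ (cst M%:E)) => //.
- exact/measurable_EFinP.
- move=> x _ /=; rewrite lee_fin [leRHS]ger0_norm ?Rintegral_ge0//.
  apply: le_trans (le_normr_Rintegral _ (iD _ _ _ ih)) _ => //.
  apply: fine_le.
  + by apply: integrable_fin_num => //; exact: iD.
  + exact: integrable_fin_num.
  + apply: ge0_subset_integral => //; by case/integrableP: ia.
- apply/integrableP; split; first exact: measurable_cst.
  rewrite integral_cst//= lte_mul_pinfty//; exact: leb01_lty.
Qed.

(* For [0 <= x <= 1] the integral below is that of [f] on [0, x]. *)
Definition volterra_fun (f : R -> K) (x : R) : K :=
  mk_scalar (\int[leb01]_(t in `[0, x]) re (f t))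
            (\int[leb01]_(t in `[0, x]) im (f t)).

Lemma volterra_fun_L1 (f : L1fun k leb01) :
  (volterra_fun f : measurableTypeR R -> K^o) \in L1_pred leb01.
Proof.
have [ir ii] := (L1_predP _ _).1 (L1funP f).
apply/L1_predP; split; rewrite /volterra_fun.
  by under eq_fun do rewrite re_mk; exact: primitive_integrable.
case: k f ir ii => f ir ii /=.
  exact: integrable0.
exact: primitive_integrable.
Qed.

Definition volterra (u : L1_01) : L1_01 :=
  \pi_(L1_01) (MkL1fun (volterra_fun_L1 (repr u))).

Lemma volterra_pi (f : L1fun k leb01) :
  volterra (\pi_(L1_01) f) = \pi_(L1_01) (MkL1fun (volterra_fun_L1 f)).
Proof.
have [ir ii] := (L1_predP _ _).1 (L1funP f).
have [jr ji] := (L1_predP _ _).1 (L1funP (repr (\pi_(L1_01) f))).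
have fE := L1_reprE f.
have m0 (h : R -> R) (D : set R) : measurable D ->
    leb01.-integrable setT (fun t => (h t)%:E) ->
    measurable_fun D (fun t => (h t)%:E).
  move=> mD ih; apply: (@measurable_funS _ _ _ _ setT) => //.
  by case/integrableP: ih.
apply/L1_piE; apply: aeW => x /=; congr mk_scalar; congr fine.
- apply: ae_eq_integral => //; [exact: m0|exact: m0|].
  by apply: filterS fE => t -> _.
- apply: ae_eq_integral => //; [exact: m0|exact: m0|].
  by apply: filterS fE => t -> _.
Qed.
End Volterra.

(* Main.v *)
Require Import Defs.
From HB Require Import structures.
From mathcomp Require Import all_boot all_order all_algebra.
From mathcomp Require Import all_classical all_reals all_analysis.
From mathcomp Require Import measurable_realfun complex ring lra zify.

(* Convolution makes L^1[0,1] a commutative algebra in which V is multiplication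
   by the constant function 1, and since the polynomials are dense, an operator
   commuting with V is a multiplier: T(f * g) = f * Tg. All multipliers commute,
   and (Df)(t) = t f(t) is a derivation, so T' = [D, T] is again a multiplier.
   Let x be a candidate vector and y = w S x with S a product of powers
   T_j^{m_j}. If some T_j occurring in S is not injective, T_j g_j = 0, then
   y * g_j = 0. Otherwise let Q be the product of the injective T_j and
   Q = T_j P_j; the Leibniz rule gives, with a = Q x,
     a * Dy = (Q D x + sum_j m_j T'_j P_j x) * y,
   so a * Dy lies in E * y for a subspace E of dimension at most n + 1 that does
   not depend on y. Both conditions are weakly closed (the second through
   finitely many determinants), and they fail at y = 1 + t^m / m! for some m:
   otherwise E would contain too many elements of different orders at 0, which
   is impossible because V is quasinilpotent. *)

(** The mechanism is logarithmic differentiation: it turns products into sums and does not see the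
    scalar w, so an orbit under n generators has its logarithmic derivatives in a finite-dimensional
    space. What is missing is division. Under truncated convolution L^1[0,1] has no unit, and every
    function vanishing on [0, 1/2] has square zero. Hence denominators are cleared by Q, and
    generators with a kernel are treated apart. The weak topology forces each condition to be tested
    by finitely many bounded functionals. Values of a convolution at a point are not defined on L^1,
    but its primitive up to s is a bounded bilinear form. The algebra is therefore used only through
    these forms, indexed by s; the product itself is never constructed, and T(f * g) = f * Tg
    appears as the adjunction of T with itself. The test vectors come from t^m / m! = V^m 1:
    modifying 1 at order m changes its logarithmic derivative by a term whose order is tied to m and
    whose coefficient is nonzero in characteristic 0. So different m yield different orders. *)

Import Order.TTheory GRing.Theory Num.Theory.
Import numFieldNormedType.Exports.

Local Open Scope classical_set_scope.
Local Open Scope ring_scope.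

Set Implicit Arguments.
Unset Strict Implicit.
Unset Printing Implicit Defensive.

Import HBNNSimple.

(** * Integration and convolution on [0, 1] *)

Section Leb01.
Context (R : realType).
Implicit Types (f g h : R -> R) (x y t : R).
Local Notation mu := (leb01 R).
Local Notation lam := (@lebesgue_measure R).
Local Notation mR := (measurableTypeR R).

Lemma leb01_fin_num : fin_num_fun mu.
Proof.
move=> A mA; rewrite ge0_fin_numE//.
by apply: le_lt_trans (leb01_lty R); apply: le_measure; rewrite ?inE.
Qed.

(* [leb01] itself is not the head of an instance, so the finiteness of the
   measure is attached to this copy. *)
Definition mu01 : set mR -> \bar R := mu.
HB.instance Definition _ := Measure.copy mu01 mu.
HB.instance Definition _ := Measure_isFinite.Build _ _ _ mu01 leb01_fin_num.

(** A simple function can be cut off outside [0, 1] without changing its integral for the restricted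
    measure, so both suprema range over the same values. Only the level set of 0 is measured
    differently on the two sides, and its weight is 0. *)
Lemma ge0_integral_leb01 (f : mR -> \bar R) : (forall x, 0 <= f x)%E ->
  (\int[mu]_x f x = \int[lam]_(x in `[0%R, 1%R]) f x)%E.
Proof.
move=> f0; have m01 := @measurable_itv R `[0, 1].
rewrite ge0_integralTE// [RHS]ge0_integralE//.
have E (h : {nnsfun mR >-> R}) : (forall x, ~ `[0, 1]%classic x -> h x = 0) ->
    sintegral mu h = sintegral lam h.
  move=> h0; rewrite /sintegral; apply: eq_fsbigr => r _.
  have [->|r0] := eqVneq r 0; first by rewrite !mul0e.
  congr (_ * _)%E; rewrite /leb01 /= /mrestr; congr (lam _).
  apply/setIidPl => x /= hx; apply: contrapT => /h0.
  by rewrite hx; exact/eqP.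
apply/eqP; rewrite eq_le; apply/andP; split.
- apply: ge_ereal_sup => _ [h hf <-].
  apply: ereal_sup_ubound; exists (proj_nnsfun h m01).
    move=> x /=; rewrite mindicE patchE /=.
    by case: ifPn; rewrite ?mulr1 ?mulr0// lee_fin.
  rewrite -E; last first.
    by move=> x nx; rewrite /= mindicE memNset ?mulr0.
  rewrite /sintegral; apply: eq_fsbigr => r _.
  have [->|r0] := eqVneq r 0; first by rewrite !mul0e.
  congr (_ * _)%E; rewrite /leb01 /= /mrestr; congr (lam _).
  by apply/seteqP; split=> x /= -[+ Dx]; rewrite mindicE mem_set ?mulr1.
- apply: ge_ereal_sup => _ [h hf <-].
  apply: ereal_sup_ubound; exists h.
    by move=> x; apply: le_trans (hf x) _; rewrite patchE; case: ifPn.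
  apply: E => x nx; have := hf x; rewrite patchE memNset// lee_fin => hx0.
  by apply/eqP; rewrite eq_le hx0 fun_ge0.
Qed.

Lemma integral_leb01 (f : mR -> \bar R) :
  (\int[mu]_x f x = \int[lam]_(x in `[0%R, 1%R]) f x)%E.
Proof. by rewrite integralE [RHS]integralE !ge0_integral_leb01. Qed.

Lemma eq_Rintegral01 f g : {in `[0, 1], f =1 g} ->
  \int[mu]_x f x = \int[mu]_x g x.
Proof.
move=> fg; rewrite /Rintegral !integral_leb01; congr fine.
by apply: eq_integral => x; rewrite inE /= => x01; rewrite fg.
Qed.

Lemma ae_leb01 (P : R -> Prop) : {in `[0, 1], forall x, P x} ->
  {ae mu, forall x, P x}.
Proof.
move=> P01; exists (~` `[0, 1]); split.
- by apply: measurableC; exact: measurable_itv.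
- by rewrite /leb01 /= /mrestr setICl measure0.
- by move=> x /= nP x01; apply/nP/P01.
Qed.

Lemma ae01S (P Q : R -> Prop) : (forall x, P x -> Q x) ->
  {ae mu, forall x, P x} -> {ae mu, forall x, Q x}.
Proof. by move=> PQ; exact: (@filterS _ _ (ae_filter_ringOfSetsType mu)). Qed.

Lemma ae01S2 (P Q S : R -> Prop) : (forall x, P x -> Q x -> S x) ->
  {ae mu, forall x, P x} -> {ae mu, forall x, Q x} -> {ae mu, forall x, S x}.
Proof. by move=> PQ; exact: (@filterS2 _ _ (ae_filter_ringOfSetsType mu)). Qed.

Definition integ f := mu.-integrable setT (fun x => (f x)%:E).

Lemma integ_meas f : integ f -> measurable_fun setT f.
Proof. by case/integrableP => /measurable_EFinP. Qed.

Lemma integ_le f g : measurable_fun setT f -> (forall x, `|f x| <= `|g x|) ->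
  integ g -> integ f.
Proof.
move=> mf fg; apply: le_integrable => //; first exact/measurable_EFinP.
by move=> x _; rewrite lee_fin.
Qed.

Lemma integ_cst r : integ (fun=> r).
Proof.
apply/integrableP; split; first exact: measurable_cst.
by rewrite integral_cst//= lte_mul_pinfty//; exact: leb01_lty.
Qed.

Lemma integ_bounded f M : measurable_fun setT f -> (forall x, `|f x| <= M) ->
  integ f.
Proof.
move=> mf fM; apply: integ_le (integ_cst M) => // x.
by apply: le_trans (fM x) _; exact: ler_norm.
Qed.

Lemma integD f g : integ f -> integ g -> integ (fun x => f x + g x).
Proof. by move=> intf intg; exact: (integrableD measurableT intf intg). Qed.

Lemma integZ r f : integ f -> integ (fun x => r * f x).
Proof. by move=> intf; exact: (integrableZl measurableT _ intf). Qed.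

Lemma integB f g : integ f -> integ g -> integ (fun x => f x - g x).
Proof. by move=> intf intg; exact: (integrableB measurableT intf intg). Qed.

Lemma integ_abs f : integ f -> integ (fun x => `|f x|).
Proof. by move=> intf; exact: (integrable_abse intf). Qed.

Lemma integ_mul f (k : mR -> R) (M : R) : measurable_fun setT k ->
  (forall x, `|k x| <= M) ->
  integ f -> integ (fun x => f x * k x).
Proof.
move=> mk kM intf.
apply: (@integ_le _ (fun x => M * f x)).
- by apply: measurable_funM => //; exact: integ_meas.
- by move=> x; rewrite !normrM mulrC ler_wpM2r// (le_trans (kM x))// ler_norm.
- exact: integZ.
Qed.

Lemma int01D f g : integ f -> integ g ->
  \int[mu]_x (f x + g x) = \int[mu]_x f x + \int[mu]_x g x.
Proof. by move=> ? ?; rewrite RintegralD. Qed.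

Lemma int01Z r f : integ f -> \int[mu]_x (r * f x) = r * \int[mu]_x f x.
Proof. by move=> ?; rewrite RintegralZl. Qed.

(** The comparison is known on [0, 1] only, while monotonicity of the integral asks for it
    everywhere; [f] is therefore replaced by its minimum with [g]. *)
Lemma int01_le f g : integ f -> integ g -> {in `[0, 1], forall x, f x <= g x} ->
  \int[mu]_x f x <= \int[mu]_x g x.
Proof.
move=> intf intg fg; rewrite -(@eq_Rintegral01 (fun x => Num.min (f x) (g x))).
  apply: le_Rintegral => //; last by move=> x _; rewrite ge_min lexx orbT.
  apply: (@integ_le _ (fun x => `|f x| + `|g x|)).
  - by apply: measurable_minr; exact: integ_meas.
  - move=> x; rewrite [leRHS]ger0_norm ?addr_ge0//.
    by case: (leP (f x) (g x)) => _; rewrite ?lerDl ?lerDr.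
  - by apply: integD; exact: integ_abs.
by move=> x x01; rewrite min_l// fg.
Qed.

Lemma int01_norm f : integ f -> `|\int[mu]_x f x| <= \int[mu]_x `|f x|.
Proof. by move=> intf; exact: le_normr_Rintegral. Qed.

Lemma int01_ge0 f : (forall x, 0 <= f x) -> 0 <= \int[mu]_x f x.
Proof. by move=> f0; apply: Rintegral_ge0 => x _; exact: f0. Qed.

Lemma int01_cst r : \int[mu]_x r = r.
Proof.
rewrite Rintegral_cst//; have -> : mu setT = 1%E; last by rewrite mulr1.
by rewrite /leb01 /= /mrestr setTI lebesgue_measure_itv /= lte_fin ltr01 oppr0
  adde0.
Qed.

Lemma int01_ae f g : integ f -> integ g -> {ae mu, forall x, f x = g x} ->
  \int[mu]_x f x = \int[mu]_x g x.
Proof.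
move=> intf intg fg; congr fine; apply: ae_eq_integral => //.
- by apply/measurable_EFinP; exact: integ_meas.
- by apply/measurable_EFinP; exact: integ_meas.
- by apply: ae01S fg => x -> _.
Qed.

Definition vol h x := \int[mu]_(t in `[0, x]) h t.

(** Moving the bound of integration into a kernel over a fixed domain gives the shape needed to
    exchange integrals. *)
Lemma volE h x : vol h x = \int[mu]_t (h t * (t <= x)%R%:R).
Proof.
rewrite /vol Rintegral_mkcond; apply: eq_Rintegral01 => t.
rewrite in_itv /= => /andP[t0 _]; rewrite patchE.
have [tx|xt] := leP t x; first by rewrite mem_set ?mulr1//= in_itv /= t0.
by rewrite memNset ?mulr0//= in_itv /= t0 /= leNgt xt.
Qed.

Lemma measurable_lec x : measurable_fun [set: mR] (fun t : mR =>
  (t <= x)%R%:R : R).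
Proof.
rewrite (_ : (fun t => _) = \1_(`]-oo, x]) :> (R -> R)); last first.
  by apply/funext => t; rewrite indicE mem_setE in_itv.
by apply: measurable_indic; exact: measurable_itv.
Qed.

Lemma normr_bool (b : bool) : `|b%:R : R| <= 1.
Proof. by case: b; rewrite ?normr1 ?normr0. Qed.

Lemma integ_vol h : integ h -> integ (vol h).
Proof. exact: primitive_integrable. Qed.

Lemma integ_lec h x : integ h -> integ (fun t => h t * (t <= x)%R%:R).
Proof.
by move=> ih; apply: integ_mul ih => [|t];
  [exact: measurable_lec|exact: normr_bool].
Qed.

Lemma vol_norm_le h x : integ h -> `|vol h x| <= vol (fun t => `|h t|) x.
Proof.
move=> ih; rewrite !volE; apply: le_trans (int01_norm (integ_lec _ ih)) _.
apply: int01_le; [exact/integ_abs/integ_lec|exact/integ_lec/integ_abs|].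
by move=> t _; rewrite normrM ler_wpM2l// ger0_norm ?ler0n.
Qed.

(** * Integral operators with a bounded measurable kernel *)

Section Kernel.
Variables (k : mR * mR -> R) (M : R).
Hypotheses (mk : measurable_fun setT k) (kM : forall z, `|k z| <= M).

Lemma measurable_kernel_l x : measurable_fun [set: mR] (fun y : mR => k (x, y)).
Proof. exact: measurableT_comp. Qed.

Lemma measurable_kernel_r y : measurable_fun [set: mR] (fun x : mR => k (x, y)).
Proof. exact: measurableT_comp. Qed.

Lemma integ_kernel_l g x : integ g -> integ (fun y => g y * k (x, y)).
Proof. by apply: integ_mul; [exact: measurable_kernel_l|move=> y; exact: kM].
Qed.

Lemma integ_kernel_r f y : integ f -> integ (fun x => f x * k (x, y)).
Proof. by apply: integ_mul; [exact: measurable_kernel_r|move=> x; exact: kM].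
Qed.

Lemma kernel_ge0 : 0 <= M. Proof. exact: le_trans (kM (0, 0)). Qed.

Lemma int_kernel_norm g x : integ g ->
  `|\int[mu]_y (g y * k (x, y))| <= M * \int[mu]_y `|g y|.
Proof.
move=> ig; apply: le_trans (int01_norm (integ_kernel_l _ ig)) _.
rewrite -int01Z; last exact: integ_abs.
apply: int01_le; [exact/integ_abs/integ_kernel_l|exact/integZ/integ_abs|].
by move=> y _; rewrite normrM mulrC ler_wpM2r.
Qed.

Let F f g (z : mR * mR) : \bar R := (f z.1 * (g z.2 * k z))%:E.

Let mF f g : integ f -> integ g -> measurable_fun setT (F f g).
Proof.
move=> /integ_meas mf /integ_meas mg; apply/measurable_EFinP.
apply: measurable_funM; first exact: measurableT_comp.
by apply: measurable_funM => //; exact: measurableT_comp.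
Qed.

Let iF f g : integ f -> integ g -> (mu01 \x mu01)%E.-integrable setT (F f g).
Proof.
move=> intf intg; apply/integrable12ltyP; first exact: mF.
rewrite (@le_lt_trans _ _
  (\int[mu]_x (`|f x| * (M * \int[mu]_y `|g y|))%:E)%E)//.
  apply: ge0_le_integral => //.
  - by move=> x _; apply: integral_ge0.
  - apply: (measurable_fun_fubini_tonelli_F
      (m2 := mu01) (fun z => `|F f g z|%E)) => //.
    by apply: measurableT_comp => //; exact: mF.
  - apply/measurable_EFinP; apply: measurable_funM => //.
    by apply: measurableT_comp => //; exact: integ_meas.
  - move=> x _.
    have iA : integ (fun y => `|f x * (g y * k (x, y))|).
      by apply: integ_abs; apply: integZ; exact: integ_kernel_l.
    rewrite [leLHS](_ : _ = (\int[mu]_y `|f x * (g y * k (x, y))|)%:E);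
      last first.
      by rewrite -[LHS]fineK//; exact: integrable_fin_num.
    rewrite lee_fin -int01Z; last exact: integ_abs.
    rewrite -int01Z; last exact/integZ/integ_abs.
    apply: int01_le => //; first exact/integZ/integZ/integ_abs.
    by move=> y _; rewrite !normrM ler_wpM2l// mulrC ler_wpM2r.
have : integ (fun x => `|f x| * (M * \int[mu]_y `|g y|)).
  by apply: integ_mul (integ_abs intf) => //; exact: measurable_cst.
move=> /integrableP[_]; apply: le_lt_trans; apply: ge0_le_integral => //.
- by move=> x _; rewrite lee_fin mulr_ge0// mulr_ge0 ?kernel_ge0// int01_ge0.
- apply/measurable_EFinP; apply: measurable_funM => //.
  by apply: measurableT_comp => //; exact: integ_meas.
- apply: measurableT_comp => //; apply/measurable_EFinP;
    apply: measurable_funM => //.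
  by apply: measurableT_comp => //; exact: integ_meas.
- by move=> x _; rewrite lee_fin ler_norm.
Qed.

Let inner_fin f g x : integ g ->
  (\int[mu]_y F f g (x, y) = (f x * \int[mu]_y (g y * k (x, y)))%:E)%E.
Proof.
move=> intg; rewrite -int01Z; last exact: integ_kernel_l.
by rewrite fineK//; apply: integrable_fin_num => //;
  exact/integZ/integ_kernel_l.
Qed.

Lemma measurable_int_kernel g : integ g ->
  measurable_fun [set: mR] (fun x : mR => \int[mu]_y (g y * k (x, y))).
Proof.
move=> intg; have i1 := integ_cst 1.
have := measurable_fubini_F (iF i1 intg).
rewrite /fubini_F [X in measurable_fun _ X](_ : _ =
  fun x => (\int[mu]_y (g y * k (x, y)))%:E) => [/measurable_EFinP//|].
by apply/funext => x; rewrite inner_fin// mul1r.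
Qed.

(** The one form of Fubini's theorem behind all identities below: Cauchy's formula for [vol], and
    the symmetry and associativity of convolution. *)
Lemma kernel_fubini f g : integ f -> integ g ->
  \int[mu]_x (f x * \int[mu]_y (g y * k (x, y))) =
  \int[mu]_y (g y * \int[mu]_x (f x * k (x, y))).
Proof.
move=> intf intg; rewrite /Rintegral; congr fine.
transitivity (\int[mu]_x \int[mu]_y F f g (x, y))%E.
  by apply: eq_integral => x _; rewrite inner_fin.
rewrite (@Fubini _ _ _ _ _ mu01 mu01 (F f g))//; last exact: iF.
apply: eq_integral => y _ /=.
have -> : (fun x => F f g (x, y)) = (fun x => (g y * (f x * k (x, y)))%:E).
  by apply/funext => x; rewrite /F /= mulrCA.
rewrite -[LHS]fineK; last first.
  by apply: integrable_fin_num => //; exact/integZ/integ_kernel_r.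
by congr EFin; rewrite -[LHS]/(\int[mu]_x (g y * (f x * k (x, y)))) int01Z//;
  exact: integ_kernel_r.
Qed.

End Kernel.

End Leb01.

(** * The Volterra operator and convolution for real functions *)

Section Volterra01.
Context (R : realType).
Implicit Types (f g h : R -> R) (x y t s : R).
Local Notation mu := (leb01 R).
Local Notation lam := (@lebesgue_measure R).
Local Notation mR := (measurableTypeR R).

Lemma measurable_ler_indic d (T : measurableType d) (f g : T -> R) :
  measurable_fun setT f -> measurable_fun setT g ->
  measurable_fun setT (fun z => (f z <= g z)%R%:R : R).
Proof.
move=> mf mg.
rewrite (_ : (fun z => _) = \1_([set z | f z <= g z])) ?funeqE; last first.
  move=> z; rewrite indicE; congr (nat_of_bool _)%:R.
  by apply/idP/idP; rewrite inE.
apply: measurable_indic; rewrite -[X in measurable X]setTI.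
exact: measurable_fun_le.
Qed.

Lemma int01_itv (u x : R) : 0 <= u -> x <= 1 ->
  \int[mu]_t ((u <= t)%R%:R * (t <= x)%R%:R) = Num.max 0 (x - u).
Proof.
move=> u0 x1.
have E t : ((u <= t)%R%:R * (t <= x)%R%:R : R) = \1_(`[u, x]%classic : set R) t.
  by rewrite indicE mem_setE in_itv /= -natrM mulnb.
under eq_Rintegral do rewrite E.
rewrite /Rintegral integral_indic//.
rewrite setIT /leb01 /= /mrestr (_ : _ `&` _ = `[u, x]%classic); last first.
  apply/setIidPl => t /=; rewrite !in_itv /= => /andP[ut tx].
  by rewrite (le_trans u0)// (le_trans tx).
rewrite lebesgue_measure_itv /= lte_fin.
case: ltP => ux /=; first by rewrite max_r// subr_ge0 ltW.
by rewrite max_l// subr_le0.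
Qed.

Let kle x (z : mR * mR) : R := (z.2 <= z.1)%R%:R * (z.1 <= x)%R%:R.

Let mkle x : measurable_fun setT (kle x).
Proof.
by apply: measurable_funM; apply: measurable_ler_indic => //;
  exact: measurableT_comp.
Qed.

Let kle1 x z : `|kle x z| <= 1.
Proof. by rewrite normrM mulr_ile1 ?normr_bool. Qed.

(** Cauchy's formula for repeated integration. The bound on [x] is needed because the measure stops
    at 1. *)
Lemma vol_vol f x : integ f -> x <= 1 ->
  vol (vol f) x = \int[mu]_u (f u * Num.max 0 (x - u)).
Proof.
move=> intf x1; rewrite volE.
transitivity (\int[mu]_t (1 * \int[mu]_u (f u * kle x (t, u)))).
  apply: eq_Rintegral => t _; rewrite mul1r volE mulrC -int01Z;
    last exact: integ_lec.
  by apply: eq_Rintegral => u _; rewrite /kle /= mulrCA; congr (_ * _);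
    exact: mulrC.
rewrite (kernel_fubini (mkle x) (kle1 x) (integ_cst 1) intf).
apply: eq_Rintegral01 => u; rewrite in_itv /= => /andP[u0 _].
rewrite -int01_itv//; congr (_ * _); apply: eq_Rintegral => t _.
by rewrite mul1r.
Qed.

(** The identity truncated to [0, 1]: functions live on the whole line, and the truncation makes
    multiplication by the variable a bounded operation there, with no change on [0, 1]. *)
Definition clip t : R := Num.max 0 (Num.min t 1).

Lemma clipE t : t \in `[0, 1] -> clip t = t.
Proof. by rewrite in_itv /= => /andP[t0 t1]; rewrite /clip min_l// max_r. Qed.

Lemma measurable_clip : measurable_fun [set: mR] (clip : mR -> R).
Proof. by apply: measurable_maxr => //; exact: measurable_minr. Qed.

Lemma clip_norm t : `|clip t| <= 1.
Proof.
by rewrite ger0_norm ?le_max ?lexx// ge_max ler01 ge_min lexx orbT.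
Qed.

Lemma integ_clip f : integ f -> integ (fun t => f t * clip t).
Proof. by apply: integ_mul; [exact: measurable_clip|exact: clip_norm]. Qed.

Lemma integ_max0 f x : integ f ->
  integ (fun u => f u * Num.max 0 (Num.min 1 (x - u))).
Proof.
apply: (@integ_mul _ _ _ 1).
  by apply: measurable_maxr => //; apply: measurable_minr => //;
    exact: measurable_funB.
by move=> u; rewrite ger0_norm ?le_max ?lexx// ge_max ler01 ge_min lexx.
Qed.

(** Write x = t + (x - t) under the integral; the second part is [vol (vol f) x] by Cauchy's
    formula. *)
Lemma clip_vol f x : integ f -> x \in `[0, 1] ->
  vol f x * clip x = vol (fun t => f t * clip t) x + vol (vol f) x.
Proof.
move=> intf x01; have x1 : x <= 1 by move: x01; rewrite in_itv => /andP[].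
rewrite clipE// vol_vol// !volE mulrC -int01Z; last exact: integ_lec.
(* The extra minimum with 1 changes nothing on [0, 1] and makes the kernel bounded on the line, as
   integrability requires. *)
have -> : \int[mu]_u (f u * Num.max 0 (x - u)) =
    \int[mu]_u (f u * Num.max 0 (Num.min 1 (x - u))).
  apply: eq_Rintegral01 => u; rewrite in_itv /= => /andP[u0 _];
    congr (_ * Num.max _ _).
  by rewrite min_r// lerBlDr (le_trans x1)// lerDl.
rewrite -int01D; [|exact/integ_lec/integ_clip|exact: integ_max0].
apply: eq_Rintegral01 => t t01; rewrite clipE//; move: t01; rewrite in_itv /=.
move=> /andP[t0 _]; have [tx|xt] := leP t x.
  have -> : Num.min 1 (x - t) = x - t by rewrite min_r; lra.
  by rewrite max_r ?subr_ge0// (_ : true%:R = 1 :> R)// !mulr1 -mulrDr addrC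
    subrK mulrC.
have -> : Num.max 0 (Num.min 1 (x - t)) = 0;
  last by rewrite (_ : false%:R = 0 :> R)// !mulr0 addr0.
by rewrite max_l// ge_min; apply/orP; right; lra.
Qed.

Lemma vol1 x : x \in `[0, 1] -> vol (fun=> 1) x = x.
Proof.
rewrite in_itv /= => /andP[x0 x1]; rewrite volE.
rewrite -(@eq_Rintegral01 _ (fun t => (0 <= t)%R%:R * (t <= x)%R%:R)).
  by rewrite int01_itv// subr0 max_r.
by move=> t; rewrite in_itv /= => /andP[-> _].
Qed.

(* The primitive, evaluated at [min s 1], of the convolution of [f] and [g];
   truncating [s] makes the lemmas below hold for every real [s]. *)
Definition conv s f g :=
  \int[mu]_u (f u * \int[mu]_v (g v * (u + v <= Num.min s 1)%R%:R)).

Let ks s (z : mR * mR) : R := (z.1 + z.2 <= Num.min s 1)%R%:R.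

Let mks s : measurable_fun setT (ks s).
Proof.
apply: (@measurable_ler_indic _ _ (fun z : mR * mR => z.1 + z.2)) => //.
exact: (measurable_funD measurable_fst measurable_snd).
Qed.

Let ks1 s z : `|ks s z| <= 1. Proof. exact: normr_bool. Qed.

Lemma convC s f g : integ f -> integ g -> conv s f g = conv s g f.
Proof.
move=> intf intg; rewrite /conv (kernel_fubini (mks s) (ks1 s) intf intg).
by apply: eq_Rintegral => v _; congr (_ * _); apply: eq_Rintegral => u _;
   rewrite /ks /= addrC.
Qed.

Let integ_conv_inner s f g : integ f -> integ g ->
  integ (fun u => f u * \int[mu]_v (g v * ks s (u, v))).
Proof.
move=> intf intg; apply: integ_mul intf; last first.
  by move=> u; exact: (int_kernel_norm (mks s) (ks1 s)).
exact: (measurable_int_kernel (mks s) (ks1 s)).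
Qed.

Lemma conv_norm s f g : integ f -> integ g ->
  `|conv s f g| <= (\int[mu]_u `|f u|) * \int[mu]_v `|g v|.
Proof.
move=> intf intg.
apply: le_trans (int01_norm (integ_conv_inner s intf intg)) _.
rewrite mulrC -int01Z; last exact: integ_abs.
apply: int01_le; [exact/integ_abs/integ_conv_inner|exact/integZ/integ_abs|].
move=> u _; rewrite normrM mulrC ler_wpM2r//.
by have := int_kernel_norm (mks s) (ks1 s) u intg; rewrite mul1r.
Qed.

Lemma convDl s f1 f2 g : integ f1 -> integ f2 -> integ g ->
  conv s (fun x => f1 x + f2 x) g = conv s f1 g + conv s f2 g.
Proof.
move=> i1 i2 ig; rewrite /conv -int01D;
  [|exact: integ_conv_inner|exact: integ_conv_inner].
by apply: eq_Rintegral => u _; rewrite mulrDl.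
Qed.

Lemma convZl s r f g : integ f -> integ g ->
  conv s (fun x => r * f x) g = r * conv s f g.
Proof.
move=> i1 ig; rewrite /conv -int01Z; last exact: integ_conv_inner.
by apply: eq_Rintegral => u _; rewrite mulrA.
Qed.

Lemma conv_ael s f1 f2 g : integ f1 -> integ f2 -> integ g ->
  {ae mu, forall x, f1 x = f2 x} -> conv s f1 g = conv s f2 g.
Proof.
move=> i1 i2 ig f12; apply: int01_ae;
  [exact: integ_conv_inner|exact: integ_conv_inner|].
by apply: ae01S f12 => x ->.
Qed.

(** By Cauchy's formula both sides integrate f(u) g(v) against the positive part of min(s, 1) - u -
    v, a kernel symmetric in u and v. *)
Lemma conv_vol s f g : integ f -> integ g ->
  conv s (vol f) g = conv s f (vol g).
Proof.
move=> intf intg.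
have E f0 g0 : integ f0 -> integ g0 -> conv s f0 (vol g0) =
    \int[mu]_u (f0 u * \int[mu]_v (g0 v * Num.max 0 (Num.min 1 (Num.min s 1 - u
      - v)))).
  move=> i0 j0; apply: eq_Rintegral01 => u; rewrite in_itv /= => /andP[u0 _].
  have s1 : Num.min s 1 - u <= 1 by rewrite lerBlDr (@le_trans _ _ 1)// ?ge_min
    ?lexx ?orbT// lerDl.
  congr (_ * _); transitivity (vol (vol g0) (Num.min s 1 - u)).
    by rewrite volE; apply: eq_Rintegral => v _; rewrite lerBrDl.
  rewrite vol_vol//; apply: eq_Rintegral01 => v;
    rewrite in_itv /= => /andP[v0 _].
  by rewrite [Num.min 1 _]min_r// lerBlDr (le_trans s1)// lerDl.
rewrite (convC s (integ_vol intf) intg) !E//.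
pose k (z : mR * mR) : R := Num.max 0 (Num.min 1 (Num.min s 1 - z.1 - z.2)).
have mk : measurable_fun setT k.
  apply: measurable_maxr => //; apply: measurable_minr => //.
  apply: measurable_funB; last exact: measurable_snd.
  by apply: measurable_funB => //; exact: measurable_fst.
have k1 z : `|k z| <= 1.
  by rewrite ger0_norm ?le_max ?lexx// ge_max ler01 ge_min lexx.
rewrite (kernel_fubini mk k1 intg intf); apply: eq_Rintegral => u _.
congr (_ * _); apply: eq_Rintegral => v _.
by rewrite /k /= -!addrA [- v - u]addrC.
Qed.

(** Convolution with 1 is the Volterra operator, and [conv] adds one more primitive. This is how the
    forms separate points. *)
Lemma conv1 s f : integ f -> conv s f (fun=> 1) = vol (vol f) (Num.min s 1).
Proof.
move=> intf; rewrite vol_vol//; last by rewrite ge_min lexx orbT.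
apply: eq_Rintegral01 => u; rewrite in_itv /= => /andP[u0 _]; congr (_ * _).
have s1 : Num.min s 1 - u <= 1 by rewrite lerBlDr (@le_trans _ _ 1)// ?ge_min
  ?lexx ?orbT// lerDl.
rewrite -[X in Num.max 0 X]subr0 -int01_itv//.
by apply: eq_Rintegral01 => v; rewrite in_itv /= => /andP[-> _];
  rewrite lerBrDl.
Qed.

Lemma vol_norm_le2 f x y : integ f -> x <= y ->
  vol (fun t => `|f t|) x <= vol (fun t => `|f t|) y.
Proof.
move=> intf xy; rewrite !volE; apply: int01_le;
  [exact/integ_lec/integ_abs|exact/integ_lec/integ_abs|].
move=> t _; rewrite ler_wpM2l// ler_nat; have [tx|//] := leP t x.
by rewrite (le_trans tx xy).
Qed.

Lemma vol_norm_ge0 f x : 0 <= vol (fun t => `|f t|) x.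
Proof. by rewrite volE; apply: int01_ge0 => t; rewrite mulr_ge0. Qed.

(** The source of quasinilpotence. With N the L^1 norm up to a point, |[vol f]| is at most N a
    before [a] and at most N b on the remaining length [b - a]; on short intervals the second term
    can be absorbed. *)
Lemma vol_norm_vol f (a b : R) : integ f -> 0 <= a -> a <= b -> b <= 1 ->
  vol (fun t => `|vol f t|) b <=
  vol (fun t => `|f t|) a + (b - a) * vol (fun t => `|f t|) b.
Proof.
move=> intf a0 ab b1; set N := vol (fun t => `|f t|).
have i2 : integ (fun t : R => (a <= t)%R%:R * (t <= b)%R%:R : R).
  apply: (@integ_bounded _ _ 1); last by move=> t;
    rewrite normrM mulr_ile1 ?normr_bool.
  by apply: measurable_funM; apply: measurable_ler_indic.
have -> : N a = \int[mu]_t N a by rewrite int01_cst.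
have -> : (b - a) * N b = \int[mu]_t (N b * ((a <= t)%R%:R * (t <= b)%R%:R)).
  by rewrite int01Z// int01_itv// max_r ?subr_ge0// mulrC.
rewrite -int01D; [|exact: integ_cst|exact: integZ].
rewrite volE; apply: int01_le.
- exact/integ_lec/integ_abs/integ_vol.
- by apply: integD; [exact: integ_cst|exact: integZ].
move=> t _; have := vol_norm_le t intf; rewrite -/N => Nt.
have [ta|/ltW at_] := leP t a.
  apply: (@le_trans _ _ (N a)); last by rewrite lerDl !mulr_ge0// vol_norm_ge0.
  apply: le_trans (vol_norm_le2 intf ta); apply: le_trans Nt.
  by rewrite ler_piMr// lern1 leq_b1.
have [tb|bt] := leP t b; last first.
  by rewrite !mulr0 addr0 vol_norm_ge0.
rewrite at_ !mulr1; apply: le_trans Nt _;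
  apply: le_trans (vol_norm_le2 intf tb) _.
by rewrite lerDr vol_norm_ge0.
Qed.

Lemma lam_integ f : integ f -> lam.-integrable `[0, 1] (EFin \o f).
Proof.
move=> /integrableP[mf finf]; apply/integrableP; split.
  exact: (measurable_funS measurableT (@subsetT _ _) mf).
by move: finf; rewrite integral_leb01.
Qed.

Lemma volE_lam f x : x <= 1 -> vol f x = \int[lam]_(t in `[0, x]) f t.
Proof.
move=> x1; rewrite /vol Rintegral_mkcond /Rintegral integral_leb01.
rewrite [in RHS]integral_mkcond [in LHS]integral_mkcond; congr fine.
apply: eq_integral => t _; rewrite !patchE !mem_setE !in_itv /=.
case: (leP 0 t) => //= t0; case: (leP t x) => tx /=; last by case: ifP.
by rewrite (le_trans tx x1).
Qed.

(** The primitive is continuous, so a nonzero value would persist on an open interval, which is not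
    a null set. *)
Lemma vol_eq0 f : integ f -> {ae mu, forall x, vol f x = 0} ->
  forall x, 0 < x < 1 -> vol f x = 0.
Proof.
move=> intf [N [mN muN sN]] x x01; apply: contrapT => nz.
have xi : x \in `]0, 1[ by rewrite in_itv.
have := parameterized_integral_continuous ler01 (lam_integ intf).
move=> /(continuous_within_itvP _ ltr01)[/(_ x xi) + _ _].
have gx : parameterized_integral lam 0 x f != 0.
  by apply/eqP; rewrite /parameterized_integral -volE_lam//;
    case/andP: x01 => _ /ltW.
move=> /cvgr_neq0 /(_ gx) => nz'.
have xo : \forall y \near x, y \in `]0, 1[ by exact: near_in_itvoo.
have [e /= e0 He] : \forall y \near x, ((y \in `]0,
  1[) /\ (parameterized_integral lam 0 y f != 0)).
  by apply: filterS2 xo nz' => y.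
have sub : (`]x - e, x + e[ `<=` N)%classic.
  move=> y; rewrite /= in_itv /= => /andP[y1 y2].
  have [] := He y; first by rewrite /= ltr_norml; apply/andP; split; lra.
  rewrite in_itv /= => /andP[y0 y1'] nzy; apply: sN => /= vy.
  by move/eqP: nzy; apply; rewrite /parameterized_integral -volE_lam ?(ltW y1').
have : (mu (`](x - e)%R, (x + e)%R[%classic : set mR) <= mu N)%E.
  by apply: le_measure => //; rewrite inE//; exact: measurable_itv.
rewrite muN /leb01 /= /mrestr (_ : _ `&` _ = `]x - e, x + e[%classic);
  last first.
  apply/setIidPl => y /=; rewrite !in_itv /= => /andP[y1 y2].
  have [] := He y; first by rewrite /= ltr_norml; apply/andP; split; lra.
  by rewrite in_itv /= => /andP[/ltW -> /ltW ->].
rewrite lebesgue_measure_itv /= lte_fin ifT; last by lra.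
by rewrite -EFinB lee_fin; apply/negP; rewrite -ltNge; lra.
Qed.

(** Lebesgue's differentiation theorem for [f] extended by 0: almost everywhere [f] is the
    derivative of a primitive that vanishes on ]0, 1[. The endpoints join the exceptional set. *)
Lemma vol_inj f : integ f -> {ae mu, forall x, vol f x = 0} ->
  {ae mu, forall x, f x = 0}.
Proof.
move=> intf /(vol_eq0 intf) v0.
have if01 := lam_integ intf.
have locf := integrable_locally_restrict (@measurable_itv R `[0, 1]) if01.
have iT : lam.-integrable setT (EFin \o (f \_ `[0, 1])).
  by rewrite -restrict_EFin; apply/integrable_restrict => //; rewrite setTI.
have : {ae lam, forall x, 0 < x < 1 -> f x = 0}.
  have iy (y : R) : lam.-integrable `]-oo, y] (EFin \o (f \_ `[0, 1])).
    exact: integrableS iT.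
  have := FTC1Ny iy locf.
  apply: filterS; first exact: (ae_filter_ringOfSetsType lam).
  move=> x [_ dF] x01; have := dF; rewrite patchE mem_set; last first.
    by rewrite /= in_itv /=; case/andP: x01 => /ltW -> /ltW ->.
  move=> <-; rewrite derive1E (@near_eq_derive _ _ _ _ (cst 0)) ?derive_cst//.
  have xi : x \in `]0, 1[ by rewrite in_itv.
  near=> y.
  have y01 : y \in `]0, 1[ by near: y; exact: near_in_itvoo.
  move: y01; rewrite in_itv /= => y01; case/andP: (y01) => y0 y1.
  transitivity (vol f y); last exact: v0.
  rewrite volE_lam ?(ltW y1)// /Rintegral; congr fine.
  rewrite integral_mkcond [RHS]integral_mkcond; apply: eq_integral => t _.
  rewrite !patchE !mem_setE !in_itv /=.
  case: (leP t y) => ty /=; last by rewrite andbF.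
  rewrite (le_trans ty (ltW y1)) !andbT.
  by case: ifP.
move=> [N [mN lN sN]]; exists ((N `|` [set 0; 1]) `|` ~` `[0, 1]); split.
- apply: measurableU; last by apply: measurableC; exact: measurable_itv.
  by apply: measurableU => //; apply: measurableU; exact: measurable_set1.
- rewrite /leb01 /= /mrestr setIUl setICl setU0.
  apply/eqP; rewrite -measure_le0.
  apply: (@le_trans _ _ (lam (N `|` [set 0; 1]))).
    apply: le_measure; rewrite ?inE.
    + apply: measurableI; last exact: measurable_itv.
      by apply: measurableU => //; apply: measurableU; exact: measurable_set1.
    + by apply: measurableU => //; apply: measurableU; exact: measurable_set1.
    + exact: subIsetl.
  have m1 (r : R) : measurable ([set r] : set mR) by exact: measurable_set1.
  have l01 : lam [set 0; 1] = 0%E.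
    apply/eqP; rewrite -measure_le0; apply: le_trans (measureU2 _ _ _) _ => //.
    have s1 (r : R) : lam [set r] = 0%E by exact: lebesgue_measure_set1.
    by rewrite -[leLHS]/(lam [set 0%R] + lam [set 1%R])%E !s1 adde0.
  apply: le_trans (measureU2 _ _ _) _ => //; first exact: measurableU.
  by rewrite -[leLHS]/(lam N + lam [set 0%R; 1%R])%E lN l01 adde0.
- move=> x /= fx; have [x01|] := boolP (x \in `[0, 1]); last first.
    by move=> nx; right; exact/negP.
  left; move: x01; rewrite in_itv /= !le_eqVlt => /andP[/orP[/eqP <-|x0]];
    first by right; left.
  move=> /orP[/eqP ->|x1]; first by right; right.
  by left; apply: sN => /= H; apply/fx/H; rewrite x0 x1.
Unshelve. all: by end_near. Qed.

End Volterra01.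

(** * Density of the polynomials *)

Section Density.
Context (R : realType).
Implicit Types (f g h : R -> R) (x y t s : R) (p q : {poly R}).
Local Notation mu := (leb01 R).
Local Notation mR := (measurableTypeR R).

Lemma integ_poly p : integ (fun x => p.[clip x]).
Proof.
elim/poly_ind: p => [|p c IH].
  rewrite (_ : (fun x => _) = fun=> 0); first exact: integ_cst.
  by apply/funext => x; rewrite horner0.
rewrite (_ : (fun x => _) = fun x => p.[clip x] * clip x + c).
  by apply: integD; [exact: integ_clip|exact: integ_cst].
by apply/funext => x; rewrite hornerMXaddC.
Qed.

Definition poly_approx f := integ f /\
  forall e : R, 0 < e -> exists p, \int[mu]_x `|f x - p.[clip x]| <= e.

Lemma poly_approx_poly p : poly_approx (fun x => p.[clip x]).
Proof.
split; first exact: integ_poly.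
move=> e e0; exists p; under eq_Rintegral do rewrite subrr normr0.
by rewrite int01_cst ltW.
Qed.

Lemma poly_approx_lim f : integ f ->
  (forall e : R, 0 < e -> exists2 g,
    poly_approx g & \int[mu]_x `|f x - g x| <= e) ->
  poly_approx f.
Proof.
move=> intf H; split=> // e e0.
have e2 : 0 < e / 2 by rewrite divr_gt0.
have [g [intg /(_ _ e2)[p gp]] fg] := H _ e2; exists p.
rewrite [e]splitr; apply: le_trans (lerD fg gp).
have ip := integ_poly p.
rewrite -int01D; [|exact/integ_abs/integB|exact/integ_abs/integB].
apply: int01_le; [exact/integ_abs/integB| |].
  by apply: integD; exact/integ_abs/integB.
by move=> x _; exact: ler_distD.
Qed.

Lemma poly_approxZD r f g : poly_approx f -> poly_approx g ->
  poly_approx (fun x => r * f x + g x).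
Proof.
move=> [intf fP] [intg gP]; split; first by apply: integD => //; exact: integZ.
move=> e e0; have r0 : 0 < `|r| + 1 by rewrite ltr_wpDl.
have [p pP] := fP (e / 2 / (`|r| + 1)) ltac:(by rewrite !divr_gt0).
have [q qP] := gP (e / 2) ltac:(by rewrite divr_gt0).
exists (r *: p + q).
have -> : e = (`|r| + 1) * (e / 2 / (`|r| + 1)) + e / 2.
  by rewrite mulrCA mulfV ?gt_eqF// mulr1 -splitr.
apply: le_trans (lerD (ler_wpM2l (ltW r0) pP) qP).
have ip := integ_poly p; have iq := integ_poly q.
have i1 : integ (fun x => `|f x - p.[clip x]|) by exact/integ_abs/integB.
have i2 : integ (fun x => `|g x - q.[clip x]|) by exact/integ_abs/integB.
rewrite -int01Z// -int01D//; last exact: integZ.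
apply: int01_le.
- apply/integ_abs/integB; last exact: integ_poly.
  by apply: integD => //; exact: integZ.
- by apply: integD => //; exact: integZ.
move=> x _; rewrite hornerD hornerZ opprD addrACA -mulrBr.
apply: le_trans (ler_normD _ _) _; rewrite lerD2r normrM ler_wpM2r//.
by rewrite lerDl.
Qed.

(** Dominated convergence with the constant bound 1, which covers both uses: steep polynomials, and
    partial sums of indicators of disjoint sets. *)
Lemma poly_approx_dct (f_ : nat -> R -> R) f :
  (forall n, poly_approx (f_ n)) -> measurable_fun setT f ->
  (forall n, {in `[0, 1], forall x, `|f_ n x| <= 1}) ->
  {ae mu, forall x, f_ n x @[n --> \oo] --> f x} -> poly_approx f.
Proof.
move=> fnP mf fn1 fnf.
have mfn n : measurable_fun [set: mR] (fun x => (f_ n x)%:E).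
  by apply/measurable_EFinP; exact: (integ_meas (fnP n).1).
have ae1 : {ae mu, forall x, [set: mR] x ->
  (f_ n x)%:E @[n --> \oo] --> (f x)%:E}.
  by apply: ae01S fnf => x fx _; apply/fine_cvgP; split => //; exact: nearW.
have ae2 : {ae mu, forall x, forall n, [set: mR] x ->
  (`|(f_ n x)%:E| <= (1 : R)%:E)%E}.
  by apply: ae_leb01 => x x01 n _; rewrite lee_fin fn1.
have := dominated_convergence (mu :=
  mu) measurableT mfn _ ae1 (integ_cst 1) ae2.
move=> []; first exact/measurable_EFinP.
move=> intf cv0 _; apply: poly_approx_lim => // e e0.
move: cv0 => /fine_cvgP[_ /cvgrPdist_le /(_ e e0)[N _ /(_ N (leqnn N))]].
rewrite /= sub0r normrN => HN; exists (f_ N); first exact: fnP.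
apply: le_trans HN; apply: le_trans (ler_norm _).
rewrite le_eqVlt; apply/orP; left; apply/eqP; congr fine.
by apply: eq_integral => x _; rewrite distrC.
Qed.

Lemma bernoulli_ineq (a : R) n : -1 <= a -> 1 + n%:R * a <= (1 + a) ^+ n.
Proof.
move=> a1; elim: n => [|n IH]; first by rewrite mul0r addr0 expr0.
rewrite exprS; have : (1 + a) * (1 + n%:R * a) <= (1 + a) * (1 + a) ^+ n.
  by apply: ler_wpM2l IH; lra.
apply: le_trans; rewrite -natr1; have : 0 <= n%:R * (a * a) :> R.
  by rewrite mulr_ge0// -expr2 sqr_ge0.
by nra.
Qed.

(* On [0, 1] the polynomials [(1 - u ^ n) ^ (2 ^ n)] converge to the indicator
   of [u < 1/2], by Bernoulli's inequality. *)
Lemma cvg_steep_lt (u : R) : 0 <= u < 2^-1 ->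
  (1 - u ^+ n) ^+ (2 ^ n) @[n --> \oo] --> (1 : R).
Proof.
move=> /andP[u0 u12]; have u1 : u <= 1 by lra.
have un n : 0 <= u ^+ n <= 1 by rewrite exprn_ge0//= exprn_ile1.
apply: (@squeeze_cvgr _ _ _ _ (fun n => 1 - (2 * u) ^+ n) (fun=> 1)).
- near=> n; have /andP[un0 un1] := un n; apply/andP; split.
    have := @bernoulli_ineq (- u ^+ n) (2 ^ n) ltac:(lra).
    by rewrite mulrN exprMn natrX.
  by rewrite exprn_ile1//; lra.
- rewrite -[X in _ --> X]subr0; apply: cvgB; first exact: cvg_cst.
  by apply: cvg_expr; rewrite ger0_norm; lra.
- exact: cvg_cst.
Unshelve. all: by end_near. Qed.

Lemma cvg_steep_gt (u : R) : 2^-1 < u <= 1 ->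
  (1 - u ^+ n) ^+ (2 ^ n) @[n --> \oo] --> (0 : R).
Proof.
move=> /andP[u12 u1]; have u0 : 0 < u by lra.
have un n : 0 < u ^+ n <= 1 by rewrite exprn_gt0//= exprn_ile1// ltW.
apply: (@squeeze_cvgr _ _ _ _ (fun=> 0) (fun n => ((2 * u)^-1) ^+ n)).
- near=> n; have /andP[un0 un1] := un n; apply/andP; split.
    by rewrite exprn_ge0//; lra.
  rewrite exprVn -div1r ler_pdivlMr ?exprn_gt0//; last by lra.
  apply: (@le_trans _ _ ((1 - u ^+ n) ^+ (2 ^ n) * (1 + u ^+ n) ^+ (2 ^ n))).
    apply: ler_wpM2l; first by rewrite exprn_ge0//; lra.
    apply: le_trans (@bernoulli_ineq (u ^+ n) (2 ^ n) ltac:(lra)).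
    by rewrite exprMn natrX lerDr.
  by rewrite -exprMn exprn_ile1//; nra.
- exact: cvg_cst.
- apply: cvg_expr; rewrite ger0_norm ?invr_ge0; last by lra.
  by rewrite invf_lt1; lra.
Unshelve. all: by end_near. Qed.

Lemma poly_approx_ae f g : integ f -> {in `[0, 1], f =1 g} -> poly_approx g ->
  poly_approx f.
Proof.
move=> intf fg gP; apply: poly_approx_lim => // e e0; exists g => //.
rewrite (@eq_Rintegral01 _ _ (fun=> 0)) ?int01_cst ?ltW//.
by move=> x x01 /=; rewrite fg// subrr normr0.
Qed.

Lemma poly_approx_cst r : poly_approx (fun=> r).
Proof.
have := poly_approx_poly r%:P.
by rewrite (_ : (fun x => _) = fun=> r)//; apply/funext => x; rewrite hornerC.
Qed.

Lemma poly_approx_le s : poly_approx (fun x => (x <= s)%R%:R).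
Proof.
have ile : integ (fun x => (x <= s)%R%:R).
  by apply: (@integ_bounded _ _ 1); [exact: measurable_lec|move=> x;
    exact: normr_bool].
have [s0|s0] := ltP s 0.
  apply: (poly_approx_ae ile) (poly_approx_cst 0) => x;
    rewrite in_itv /= => /andP[x0 _].
  by rewrite leNgt (lt_le_trans s0 x0).
have [s1|s1] := ltP 1 s.
  apply: (poly_approx_ae ile) (poly_approx_cst 1) => x;
    rewrite in_itv /= => /andP[_ x1].
  by rewrite (le_trans x1 (ltW s1)).
(* This affine map sends [0, 1] into itself and moves the jump at [s] to 1/2, the jump of the steep
   polynomials. *)
pose u x : R := (clip x - s + 1) / 2.
pose q : {poly R} := 2^-1 *: ('X - s%:P + 1).
have uq x : u x = q.[clip x].
  by rewrite /u /q hornerZ hornerD hornerXsubC hornerC mulrC.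
have u01 x : x \in `[0, 1] -> 0 <= u x <= 1.
  move=> x01; rewrite /u clipE//; move: x01; rewrite in_itv /= => /andP[x0 x1].
  by apply/andP; split; lra.
apply: (@poly_approx_dct (fun n x => (1 - u x ^+ n) ^+ (2 ^ n))).
- move=> n; rewrite (_ : (fun x => _) = fun x =>
    ((1 - q ^+ n) ^+ (2 ^ n)).[clip x]).
    exact: poly_approx_poly.
  by apply/funext => x; rewrite uq horner_exp hornerD hornerN hornerC
    horner_exp.
- exact: measurable_lec.
- move=> n x /u01 /andP[u0 u1]; rewrite normrX exprn_ile1//.
  have := exprn_ge0 n u0; have := exprn_ile1 n u0 u1.
  by move=> h1 h2; rewrite ler_norml; apply/andP; split; lra.
(* At [s] the variable [u] is 1/2, where neither limit lemma applies; the point is discarded as a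
   null set. *)
- have aes : {ae mu, forall x, x != s}.
    exists [set s]; split; first exact: measurable_set1.
      rewrite /leb01 /= /mrestr; apply/eqP; rewrite -measure_le0.
      apply: le_trans (_ : (lebesgue_measure [set s] <= 0)%E).
        by apply: le_measure; rewrite ?inE; [apply: measurableI;
          [exact: measurable_set1|exact: measurable_itv]|exact:
            measurable_set1|exact: subIsetl].
      by rewrite lebesgue_measure_set1.
    by move=> x /= /negP; rewrite negbK => /eqP.
  have ax : {ae mu, forall x, x \in `[0, 1]} by exact: ae_leb01.
  apply: ae01S2 aes ax => x xs x01; have /andP[u0 u1] := u01 x x01.
  have cx := clipE x01; case: ltgtP xs => // xs _.
    by apply: cvg_steep_lt; rewrite u0 /u cx; lra.
  by apply: cvg_steep_gt; rewrite u1 andbT /u cx; lra.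
Qed.

Lemma poly_approxD f g : poly_approx f -> poly_approx g ->
  poly_approx (fun x => f x + g x).
Proof.
move=> fP gP; have := poly_approxZD 1 fP gP.
by rewrite (_ : (fun x => 1 * f x + g x) = fun x => f x + g x)//;
   apply/funext => x; rewrite mul1r.
Qed.

Lemma poly_approx_indicC (A : set mR) : poly_approx \1_A ->
  poly_approx \1_(~` A).
Proof.
move=> AP; have := poly_approxZD (-1) AP (poly_approx_cst 1).
rewrite (_ : (fun x => -1 * \1_A x + 1) = \1_(~` A))//.
by apply/funext => x; rewrite !indicE in_setC; case: (x \in A) => /=; lra.
Qed.

(** Dynkin's theorem: the open half-lines are stable under intersection and generate the Borel sets,
    and the property passes to complements and countable disjoint unions. *)
Lemma poly_approx_indic (A : set mR) : measurable A -> poly_approx \1_A.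
Proof.
rewrite -[measurable A]/((R.-ocitv).-measurable.-sigma.-measurable A).
have GE := RGenOInfty.measurableE R.
rewrite (_ : (R.-ocitv).-measurable.-sigma.-measurable A = <<s @RGenOInfty.G R
  >> A); last first.
  by rewrite GE.
apply: (@dynkin_induction _ mR (@RGenOInfty.G R) (fun A : set mR =>
  poly_approx \1_A)).
- exact: GE.
- move=> _ _ [x ->] [y ->]; exists (Num.max x y).
  apply/seteqP; split => t /=; rewrite !in_itv /= !andbT gt_max.
    by move=> [-> ->].
  by move=> /andP[].
- by rewrite indicT; exact: poly_approx_cst.
- move=> _ [x ->]; rewrite (_ : `]x, +oo[%classic = ~` `]-oo, x]%classic);
    last first.
    by apply/seteqP; split => t /=; rewrite !in_itv /= andbT ltNge;
      move=> /negP.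
  apply: poly_approx_indicC; rewrite (_ : \1__ = fun t => (t <= x)%R%:R);
    first exact: poly_approx_le.
  by apply/funext => t; rewrite indicE mem_setE in_itv.
- by move=> S _; exact: poly_approx_indicC.
- move=> F mF tF FP.
  (* Disjointness makes each partial sum an indicator, hence bounded by 1. *)
  have S01 n x : \sum_(k < n) \1_(F k) x = \1_(\bigcup_(k in `I_n) F k) x :> R.
    elim: n => [|n IH]; first by rewrite big_ord0 II0 bigcup_set0 indic0.
    rewrite big_ord_recr /= IH IIS bigcup_setU bigcup_set1 !indicE in_setU.
    have [xF|] := boolP (x \in F n); last by rewrite addr0 orbF.
    rewrite orbT (_ : (x \in \bigcup_(k in `I_n) F k) = false) ?add0r//;
      apply/negP.
    rewrite inE => -[k /= kn Fk]; have := tF k n I I.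
    by move=> E; move: kn; rewrite E ?ltnn//; exists x; split => //;
      rewrite inE in xF.
  apply: (@poly_approx_dct (fun n x => \sum_(k < n) \1_(F k) x)).
  + elim=> [|n IH].
      rewrite (_ : (fun x => _) = fun=> 0); first exact: poly_approx_cst.
      by apply/funext => x; rewrite big_ord0.
    rewrite (_ : (fun x => _) = fun x => \sum_(k < n) \1_(F k) x + \1_(F n) x).
      exact: poly_approxD.
    by apply/funext => x; rewrite big_ord_recr.
  + by apply: measurable_indic; apply: bigcup_measurable => n _; exact: mF.
  + by move=> n x _; rewrite S01 indicE normr_bool.
  + apply: ae_leb01 => x _; apply: cvg_near_cst.
    have [xF|nF] := pselect ((\bigcup_k F k) x).
      have [k _ Fk] := xF; exists k.+1 => // n /= kn.
      by rewrite S01 !indicE !mem_set//; exists k.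
    apply: nearW => n; rewrite S01 !indicE !memNset// => -[k _ Fk].
    by apply: nF; exists k.
Qed.

Import HBSimple.

Lemma poly_approx_sfun (g : {sfun mR >-> R}) : poly_approx g.
Proof.
rewrite (_ : (g : mR -> R) = fun x =>
  \sum_(y <- finmap.enum_fset (fset_set (range g))) (y * \1_(g @^-1` [set y])
    x)).
  elim: (finmap.enum_fset _) => [|y s IH].
    rewrite (_ : (fun x => _) = fun=> 0); first exact: poly_approx_cst.
    by apply/funext => x; rewrite big_nil.
  rewrite (_ : (fun x => _) = fun x => y * \1_(g @^-1` [set y]) x +
      \sum_(y <- s) (y * \1_(g @^-1` [set y]) x)).
    by apply: poly_approxZD IH; apply: poly_approx_indic;
      exact: measurable_sfunP.
  by apply/funext => x; rewrite big_cons.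
by apply/funext => x; rewrite (fimfunE g) fsbig_finite.
Qed.

Lemma poly_dense f : integ f -> poly_approx f.
Proof.
move=> intf; apply: poly_approx_lim => // e e0.
have [g [_ _ /fine_cvgP[_ /cvgrPdist_le /(_ e e0)[N _ /(_ N (leqnn N))]]]] :=
  approximation_sfun_integrable measurableT intf.
rewrite /= sub0r normrN => HN; exists (g N); first exact: poly_approx_sfun.
apply: le_trans HN; apply: le_trans (ler_norm _).
rewrite le_eqVlt; apply/orP; left; apply/eqP; congr fine.
Qed.

End Density.

Section VolLinear.
Context (R : realType).
Implicit Types (f g h : R -> R) (x y t s : R).
Local Notation mu := (leb01 R).

Lemma vol_ae f g x : integ f -> integ g -> {ae mu, forall t, f t = g t} ->
  vol f x = vol g x.
Proof.
move=> intf intg fg; rewrite !volE; apply: int01_ae;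
  [exact: integ_lec|exact: integ_lec|].
by apply: ae01S fg => t ->.
Qed.

Lemma volD f g x : integ f -> integ g ->
  vol (fun t => f t + g t) x = vol f x + vol g x.
Proof.
move=> intf intg; rewrite !volE -int01D; [|exact: integ_lec|exact: integ_lec].
by apply: eq_Rintegral => t _; rewrite mulrDl.
Qed.

Lemma volZ r f x : integ f -> vol (fun t => r * f t) x = r * vol f x.
Proof.
move=> intf; rewrite !volE -int01Z; last exact: integ_lec.
by apply: eq_Rintegral => t _; rewrite mulrA.
Qed.

Lemma vol0 x : vol (fun=> 0 : R) x = 0.
Proof. by rewrite volE; under eq_Rintegral do rewrite mul0r; rewrite int01_cst.
Qed.

Lemma conv_aer s f g1 g2 : integ f -> integ g1 -> integ g2 ->
  {ae mu, forall x, g1 x = g2 x} -> conv s f g1 = conv s f g2.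
Proof. by move=> i1 i2 i3 g12; rewrite !(convC s i1)//; exact: conv_ael. Qed.

Lemma conv0l s g : conv s (fun=> 0) g = 0.
Proof. by rewrite /conv; under eq_Rintegral do rewrite mul0r;
  rewrite int01_cst. Qed.

End VolLinear.

(** * The Volterra algebra L^1[0, 1] *)

Section L1Volterra.
Local Open Scope quotient_scope.
Context (R : realType) (k : scalar_kind).
Local Notation K := (Defs.scalar R k).
Local Notation mu := (leb01 R).
Local Notation mR := (measurableTypeR R).
Local Notation X := (L1 k mu).
Local Notation V := (@volterra R k).
Implicit Types (u v w : X) (a : K).

Lemma scalar_eq (x y : K) : re x = re y -> im x = im y -> x = y.
Proof. by move=> r i; rewrite (scalarE x) (scalarE y) r i. Qed.

(** The condition on [b] is there because [mk_scalar] drops its second argument over the reals. *)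
Lemma im_mk (a b : R) : (k = RealScalars -> b = 0) ->
  im (mk_scalar a b : K) = b.
Proof. by case: k => // ->. Qed.

Definition reL1 u (t : R) : R := re (repr u t).
Definition imL1 u (t : R) : R := im (repr u t).

Lemma imL1_real u : k = RealScalars -> imL1 u = fun=> 0.
Proof.
move=> k0; apply/funext => t; rewrite /imL1; move: (repr u t : Defs.scalar R k).
by rewrite k0.
Qed.

Lemma integ_reL1 u : integ (reL1 u). Proof.
by have [] := (L1_predP _ _).1 (L1funP (repr u)). Qed.
Lemma integ_imL1 u : integ (imL1 u). Proof.
by have [] := (L1_predP _ _).1 (L1funP (repr u)). Qed.
#[local] Hint Resolve integ_reL1 integ_imL1 : core.

Definition aeq (f g : R -> R) := {ae mu, forall t, f t = g t}.

Lemma aeq_trans f g h : aeq f g -> aeq g h -> aeq f h.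
Proof. by apply: ae01S2 => t -> ->. Qed.

Lemma aeq_sym f g : aeq f g -> aeq g f.
Proof. by apply: ae01S => t ->. Qed.

Lemma aeq_pt f g : f =1 g -> aeq f g.
Proof. by move=> fg; apply: (ae01S (fun t _ => fg t)) (ae_leb01 (P :=
  fun=> True) _). Qed.

Lemma reL1_pi (f : L1fun k mu) : aeq (reL1 (\pi_X f)) (fun t => re (f t)).
Proof. by apply: (ae01S _ (L1_reprE f)) => t; rewrite /reL1 => ->. Qed.

Lemma imL1_pi (f : L1fun k mu) : aeq (imL1 (\pi_X f)) (fun t => im (f t)).
Proof. by apply: (ae01S _ (L1_reprE f)) => t; rewrite /imL1 => ->. Qed.

Lemma L1_eq u v : aeq (reL1 u) (reL1 v) -> aeq (imL1 u) (imL1 v) -> u = v.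
Proof.
move=> ruv iuv; rewrite -[u]reprK -[v]reprK; apply/L1_piE.
by apply: ae01S2 ruv iuv => t; exact: scalar_eq.
Qed.

Lemma L1_pi_lin a u v : a *: u + v = \pi_X (a *: repr u + repr v).
Proof.
rewrite -{1}[u]reprK -{1}[v]reprK -[X in X + _]/(L1_scale a (\pi_X (repr u))).
by rewrite L1_pi_scale L1_pi_add.
Qed.

Lemma reL1_lin a u v :
  aeq (reL1 (a *: u + v)) (fun t =>
    re a * reL1 u t - im a * imL1 u t + reL1 v t).
Proof.
rewrite L1_pi_lin; apply: aeq_trans (reL1_pi _) _; apply: aeq_pt => t.
by rewrite -[X in re X]/(a * repr u t + repr v t) reD reM.
Qed.

Lemma imL1_lin a u v :
  aeq (imL1 (a *: u + v)) (fun t =>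
    re a * imL1 u t + im a * reL1 u t + imL1 v t).
Proof.
rewrite L1_pi_lin; apply: aeq_trans (imL1_pi _) _; apply: aeq_pt => t.
by rewrite -[X in im X]/(a * repr u t + repr v t) imD imM.
Qed.

Lemma reL1_V u : aeq (reL1 (V u)) (vol (reL1 u)).
Proof.
by rewrite /volterra; apply: aeq_trans (reL1_pi _) _; apply: aeq_pt => t /=;
  rewrite re_mk.
Qed.

Lemma imL1_V u : aeq (imL1 (V u)) (vol (imL1 u)).
Proof.
rewrite /volterra; apply: aeq_trans (imL1_pi _) _; apply: aeq_pt => t;
  rewrite /= im_mk// => k0.
by rewrite -[LHS]/(vol (imL1 u) t) imL1_real// vol0.
Qed.

Lemma mulclip_L1 (f : L1fun k mu) :
  (fun t => of_real (clip t) * (f t : K) : K^o) \in L1_pred mu.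
Proof.
have [ir ii] := (L1_predP _ _).1 (L1funP f).
have im0' (r : R) : im (of_real r : K) = 0 by rewrite im_mk.
apply/L1_predP; split.
- rewrite (_ : (fun t => _) = fun t => (re (f t) * clip t)%:E);
    first exact: integ_clip.
  by apply/funext => t; rewrite reM re_mk im0' mul0r subr0 mulrC.
- rewrite (_ : (fun t => _) = fun t => (im (f t) * clip t)%:E);
    first exact: integ_clip.
  by apply/funext => t; rewrite imM re_mk im0' mul0r addr0 mulrC.
Qed.

(** The derivation D of the overview. *)
Definition mulX01 u : X := \pi_X (MkL1fun (mulclip_L1 (repr u))).

Lemma reL1_mulX01 u : aeq (reL1 (mulX01 u)) (fun t => reL1 u t * clip t).
Proof.
rewrite /mulX01; apply: aeq_trans (reL1_pi _) _; apply: aeq_pt => t;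
  rewrite /= reM re_mk.
by rewrite (_ : im (of_real _) = 0) ?im_mk// mul0r subr0 mulrC.
Qed.

Lemma imL1_mulX01 u : aeq (imL1 (mulX01 u)) (fun t => imL1 u t * clip t).
Proof.
rewrite /mulX01; apply: aeq_trans (imL1_pi _) _; apply: aeq_pt => t;
  rewrite /= imM re_mk.
by rewrite (_ : im (of_real _) = 0) ?im_mk// mul0r addr0 mulrC.
Qed.

Lemma oneL1_L1 : (fun=> 1 : K^o) \in L1_pred mu.
Proof.
have -> : (fun=> 1 : K^o) = (fun t : mR => of_real 1 : K^o).
  by apply/funext => t; rewrite /of_real; case: k.
by apply/L1_predP; split; [rewrite re_mk|rewrite im_mk//]; exact: integ_cst.
Qed.

Definition oneL1 : X := \pi_X (MkL1fun oneL1_L1).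

Lemma reL1_oneL1 : aeq (reL1 oneL1) (fun=> 1).
Proof. by rewrite /oneL1; apply: aeq_trans (reL1_pi _) _;
  apply: aeq_pt => t /=; case: k. Qed.

Lemma imL1_oneL1 : aeq (imL1 oneL1) (fun=> 0).
Proof. by rewrite /oneL1; apply: aeq_trans (imL1_pi _) _;
  apply: aeq_pt => t /=; case: k. Qed.

Lemma mulX01_lin a u v : mulX01 (a *: u + v) = a *: mulX01 u + mulX01 v.
Proof.
apply: L1_eq.
- apply: aeq_trans (reL1_mulX01 _) _; apply: aeq_sym;
    apply: aeq_trans (reL1_lin _ _ _) _.
  have H := ae01S2 (fun t e1 e2 => conj e1 e2) (reL1_mulX01 u) (imL1_mulX01 u).
  have H' := ae01S2 (fun t e1 e2 =>
    conj e1 e2) (reL1_mulX01 v) (reL1_lin a u v).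
  by apply: ae01S2 H H' => t [-> ->] [-> ->]; ring.
- apply: aeq_trans (imL1_mulX01 _) _; apply: aeq_sym;
    apply: aeq_trans (imL1_lin _ _ _) _.
  have H := ae01S2 (fun t e1 e2 => conj e1 e2) (reL1_mulX01 u) (imL1_mulX01 u).
  have H' := ae01S2 (fun t e1 e2 =>
    conj e1 e2) (imL1_mulX01 v) (imL1_lin a u v).
  by apply: ae01S2 H H' => t [-> ->] [-> ->]; ring.
Qed.

Lemma integ_lin (a b : R) f g h : integ f -> integ g -> integ h ->
  integ (fun t => a * f t - b * g t + h t).
Proof. by move=> *; apply: integD => //; apply: integB; exact: integZ. Qed.

Lemma integ_lin' (a b : R) f g h : integ f -> integ g -> integ h ->
  integ (fun t => a * f t + b * g t + h t).
Proof. by move=> *; apply: integD => //; apply: integD; exact: integZ. Qed.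

Lemma vol_reL1_lin a u v x : vol (reL1 (a *: u + v)) x =
  re a * vol (reL1 u) x - im a * vol (imL1 u) x + vol (reL1 v) x.
Proof.
rewrite (vol_ae _ _ _ (reL1_lin a u v))//; last exact: integ_lin.
rewrite (@volD _ (fun t => re a * reL1 u t - im a * imL1 u t))//;
  last by apply: integB; exact: integZ.
congr (_ + _); rewrite -!volZ// -mulN1r -volZ; last exact: integZ.
rewrite -volD; [|exact: integZ|by apply: integZ; exact: integZ].
by congr vol; apply/funext => t; rewrite mulN1r.
Qed.

Lemma vol_imL1_lin a u v x : vol (imL1 (a *: u + v)) x =
  re a * vol (imL1 u) x + im a * vol (reL1 u) x + vol (imL1 v) x.
Proof.
rewrite (vol_ae _ _ _ (imL1_lin a u v))//; last exact: integ_lin'.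
rewrite (@volD _ (fun t => re a * imL1 u t + im a * reL1 u t))//;
  last by apply: integD; exact: integZ.
by rewrite (@volD _ (fun t => re a * imL1 u t)) ?volZ//; exact: integZ.
Qed.

Lemma volterra_lin a u v : V (a *: u + v) = a *: V u + V v.
Proof.
apply: L1_eq.
- apply: aeq_trans (reL1_V _) _; apply: aeq_sym;
    apply: aeq_trans (reL1_lin _ _ _) _.
  have H := ae01S2 (fun t e1 e2 => conj e1 e2) (reL1_V u) (imL1_V u).
  by apply: ae01S2 H (reL1_V v) => t [-> ->] ->; rewrite vol_reL1_lin.
- apply: aeq_trans (imL1_V _) _; apply: aeq_sym;
    apply: aeq_trans (imL1_lin _ _ _) _.
  have H := ae01S2 (fun t e1 e2 => conj e1 e2) (reL1_V u) (imL1_V u).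
  by apply: ae01S2 H (imL1_V v) => t [-> ->] ->; rewrite vol_imL1_lin.
Qed.

Lemma reL1D u v : aeq (reL1 (u + v)) (fun t => reL1 u t + reL1 v t).
Proof.
have := reL1_lin 1 u v; rewrite scale1r; apply: ae01S => t ->.
by congr (_ + _); case: k => /=; rewrite mul1r mul0r subr0.
Qed.

Lemma imL1D u v : aeq (imL1 (u + v)) (fun t => imL1 u t + imL1 v t).
Proof.
have := imL1_lin 1 u v; rewrite scale1r; apply: ae01S => t ->.
by congr (_ + _); case: k => /=; rewrite mul1r mul0r addr0.
Qed.

Lemma clip_vol_ae f g h : integ f -> aeq g (vol f) ->
  aeq h (fun t => f t * clip t) -> integ h -> integ g ->
  aeq (fun t => g t * clip t) (fun t => vol h t + vol g t).
Proof.
move=> intf gf hf inth intg.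
have a01 : {ae mu, forall t, t \in `[0, 1]} by exact: ae_leb01.
apply: ae01S2 (gf) a01 => t -> t01; rewrite clip_vol//; congr (_ + _).
- by apply: vol_ae => //; [exact: integ_clip|exact: aeq_sym].
- by apply: vol_ae => //; [exact: integ_vol|exact: aeq_sym].
Qed.

(** The Leibniz rule for the product 1 * u, since D 1 = V 1 = 1 * 1. *)
Lemma mulX01_V u : mulX01 (V u) = V (mulX01 u) + V (V u).
Proof.
apply: L1_eq.
- apply: aeq_trans (reL1_mulX01 _) _; apply: aeq_sym;
    apply: aeq_trans (reL1D _ _) _.
  have H := clip_vol_ae (integ_reL1 u) (reL1_V u) (reL1_mulX01 u) (integ_reL1
    _) (integ_reL1 _).
  have H' := ae01S2 (fun t e1 e2 =>
    conj e1 e2) (reL1_V (mulX01 u)) (reL1_V (V u)).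
  by apply: ae01S2 H H' => t -> [-> ->].
- apply: aeq_trans (imL1_mulX01 _) _; apply: aeq_sym;
    apply: aeq_trans (imL1D _ _) _.
  have H := clip_vol_ae (integ_imL1 u) (imL1_V u) (imL1_mulX01 u) (integ_imL1
    _) (integ_imL1 _).
  have H' := ae01S2 (fun t e1 e2 =>
    conj e1 e2) (imL1_V (mulX01 u)) (imL1_V (V u)).
  by apply: ae01S2 H H' => t -> [-> ->].
Qed.

Lemma mulX01_oneL1 : mulX01 oneL1 = V oneL1.
Proof.
have a01 : {ae mu, forall t, t \in `[0, 1]} by exact: ae_leb01.
apply: L1_eq.
- apply: aeq_trans (reL1_mulX01 _) _; apply: aeq_sym;
    apply: aeq_trans (reL1_V _) _.
  apply: ae01S2 reL1_oneL1 a01 => t -> t01.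
  by rewrite (vol_ae _ _ _ reL1_oneL1)//;
    [rewrite vol1// mul1r clipE|exact: integ_cst].
- apply: aeq_trans (imL1_mulX01 _) _; apply: aeq_sym;
    apply: aeq_trans (imL1_V _) _.
  apply: ae01S imL1_oneL1 => t ->; rewrite mul0r.
  by rewrite (vol_ae _ _ _ imL1_oneL1)//; [exact: vol0|exact: integ_cst].
Qed.

Lemma L1_zero : 0 = \pi_X 0. Proof. by rewrite piE. Qed.

Lemma reL10 : aeq (reL1 0) (fun=> 0).
Proof. by rewrite L1_zero; apply: aeq_trans (reL1_pi _) _; apply: aeq_pt => t;
  exact: re0. Qed.

Lemma imL10 : aeq (imL1 0) (fun=> 0).
Proof. by rewrite L1_zero; apply: aeq_trans (imL1_pi _) _; apply: aeq_pt => t;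
  exact: im0. Qed.

Lemma volterra_inj u : V u = 0 -> u = 0.
Proof.
move=> Vu0; apply: L1_eq.
- apply: aeq_trans (aeq_sym reL10); apply: vol_inj => //.
  by apply: aeq_trans (aeq_sym (reL1_V u)) _; rewrite Vu0; exact: reL10.
- apply: aeq_trans (aeq_sym imL10); apply: vol_inj => //.
  by apply: aeq_trans (aeq_sym (imL1_V u)) _; rewrite Vu0; exact: imL10.
Qed.

Definition nrmL1 u : R := L1_seminorm (repr u).

Lemma normE u : `|u| = of_real (nrmL1 u) :> K. Proof. by []. Qed.

Lemma integ_modulus u : integ (fun t => modulus (repr u t)).
Proof. exact: L1fun_integrable. Qed.

Lemma nrmL1_ge0 u : 0 <= nrmL1 u.
Proof. by apply: int01_ge0 => t; exact: modulus_ge0. Qed.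

Lemma reL1_nrmL1 u : \int[mu]_t `|reL1 u t| <= nrmL1 u.
Proof.
apply: int01_le; [exact/integ_abs|exact: integ_modulus|].
by move=> t _; exact: re_le_modulus.
Qed.

Lemma imL1_nrmL1 u : \int[mu]_t `|imL1 u t| <= nrmL1 u.
Proof.
apply: int01_le; [exact/integ_abs|exact: integ_modulus|].
by move=> t _; exact: im_le_modulus.
Qed.

Lemma nrmL1_le u : nrmL1 u <= \int[mu]_t `|reL1 u t| + \int[mu]_t `|imL1 u t|.
Proof.
rewrite -int01D; [|exact/integ_abs|exact/integ_abs].
apply: int01_le; [exact: integ_modulus|by apply: integD; exact/integ_abs|].
by move=> t _; exact: modulus_le.
Qed.

Lemma int_abs_ae f g : integ f -> integ g -> aeq f g ->
  \int[mu]_t `|f t| = \int[mu]_t `|g t|.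
Proof.
move=> i1 i2 E; apply: int01_ae; [exact: integ_abs|exact: integ_abs|].
by apply: ae01S E => t ->.
Qed.

Lemma int_clip_le f : integ f ->
  \int[mu]_t `|f t * clip t| <= \int[mu]_t `|f t|.
Proof.
move=> i; apply: int01_le; [exact/integ_abs/integ_clip|exact/integ_abs|].
by move=> t _; rewrite normrM ler_piMr// clip_norm.
Qed.

(** The factor 2 comes from estimating real and imaginary parts separately; likewise the factor 4
    for [convL1]. *)
Lemma mulX01_nrmL1 u : nrmL1 (mulX01 u) <= 2%:R * nrmL1 u.
Proof.
apply: le_trans (nrmL1_le _) _; rewrite mulr_natl mulr2n; apply: lerD.
- rewrite (int_abs_ae _ _ (reL1_mulX01 u))//; last exact: integ_clip.
  exact: le_trans (int_clip_le _) (reL1_nrmL1 u).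
- rewrite (int_abs_ae _ _ (imL1_mulX01 u))//; last exact: integ_clip.
  exact: le_trans (int_clip_le _) (imL1_nrmL1 u).
Qed.

(** The [K]-bilinear extension of [conv s], without conjugation. *)
Definition convL1 (s : R) u v : K :=
  mk_scalar (conv s (reL1 u) (reL1 v) - conv s (imL1 u) (imL1 v))
            (conv s (reL1 u) (imL1 v) + conv s (imL1 u) (reL1 v)).

Lemma re_convL1 s u v : re (convL1 s u v) = conv s (reL1 u) (reL1 v) - conv s
  (imL1 u) (imL1 v).
Proof. by rewrite re_mk. Qed.

Lemma im_convL1 s u v : im (convL1 s u v) = conv s (reL1 u) (imL1 v) + conv s
  (imL1 u) (reL1 v).
Proof.
rewrite im_mk// => k0; rewrite !imL1_real// conv0l addr0.
by rewrite convC ?conv0l//; exact: integ_cst.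
Qed.

Lemma convL1_sym s u v : convL1 s u v = convL1 s v u.
Proof.
apply: scalar_eq.
- by rewrite (re_convL1 s u v) (re_convL1 s v u) (convC s (integ_reL1 u)
    (integ_reL1 v)) (convC s (integ_imL1 u) (integ_imL1 v)).
- by rewrite (im_convL1 s u v) (im_convL1 s v u) (convC s (integ_reL1 u)
    (integ_imL1 v)) (convC s (integ_imL1 u) (integ_reL1 v)); exact: addrC.
Qed.

Lemma conv_lin s (a b : R) f g h l : integ f -> integ g -> integ h -> integ l ->
  conv s (fun t => a * f t - b * g t + h t) l =
  a * conv s f l - b * conv s g l + conv s h l.
Proof.
move=> i1 i2 i3 i4.
rewrite (@convDl _ s (fun t => a * f t - b * g t))//; last by apply: integB;
  exact: integZ.
congr (_ + _); rewrite -convZl// -mulNr -convZl// -convDl//;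
  [|exact: integZ|exact: integZ].
by congr conv; apply/funext => t; rewrite mulNr.
Qed.

Lemma conv_lin' s (a b : R) f g h l : integ f -> integ g -> integ h ->
  integ l ->
  conv s (fun t => a * f t + b * g t + h t) l =
  a * conv s f l + b * conv s g l + conv s h l.
Proof.
move=> i1 i2 i3 i4.
have := conv_lin s a (- b) i1 i2 i3 i4; rewrite mulNr opprK => <-.
by congr conv; apply/funext => t; rewrite mulNr opprK.
Qed.

Lemma convL1_linl s v a u w : convL1 s (a *: u + w) v = a * convL1 s u v +
  convL1 s w v.
Proof.
have H1 f : integ f -> conv s (reL1 (a *: u + w)) f =
    re a * conv s (reL1 u) f - im a * conv s (imL1 u) f + conv s (reL1 w) f.
  move=> i; rewrite -conv_lin//; apply: conv_ael => //; first exact: integ_lin.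
  exact: reL1_lin.
have H2 f : integ f -> conv s (imL1 (a *: u + w)) f =
    re a * conv s (imL1 u) f + im a * conv s (reL1 u) f + conv s (imL1 w) f.
  move=> i; rewrite -conv_lin'//; apply: conv_ael => //;
    first exact: integ_lin'.
  exact: imL1_lin.
apply: scalar_eq.
- rewrite reD reM (re_convL1 s (a *: u + w)) (re_convL1 s u) (re_convL1 s w)
    (im_convL1 s u).
  rewrite (H1 _ (integ_reL1 v)) (H2 _ (integ_imL1 v)).
  move: (conv s (reL1 u) (reL1 v)) (conv s (imL1 u) (reL1 v)) (conv s (reL1 w)
    (reL1 v)).
  move: (conv s (reL1 u) (imL1 v)) (conv s (imL1 u) (imL1 v)) (conv s (reL1 w)
    (imL1 v)).
  move: (conv s (imL1 w) (reL1 v)) (conv s (imL1 w) (imL1 v)) => *; ring.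
- rewrite imD imM (im_convL1 s (a *: u + w)) (im_convL1 s u) (im_convL1 s w)
    (re_convL1 s u).
  rewrite (H1 _ (integ_imL1 v)) (H2 _ (integ_reL1 v)).
  move: (conv s (reL1 u) (reL1 v)) (conv s (imL1 u) (reL1 v)) (conv s (reL1 w)
    (reL1 v)).
  move: (conv s (reL1 u) (imL1 v)) (conv s (imL1 u) (imL1 v)) (conv s (reL1 w)
    (imL1 v)).
  move: (conv s (imL1 w) (reL1 v)) (conv s (imL1 w) (imL1 v)) => *; ring.
Qed.

Lemma convL1_V s u v : convL1 s (V u) v = convL1 s u (V v).
Proof.
have Hl f g h : integ f -> integ g -> integ h -> aeq g (vol f) ->
    conv s g h = conv s f (vol h).
  move=> i1 i2 i3 E; rewrite -conv_vol//; apply: conv_ael => //;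
    exact: integ_vol.
have Hr f g h : integ f -> integ g -> integ h -> aeq g (vol h) ->
    conv s f g = conv s f (vol h).
  by move=> i1 i2 i3 E; apply: conv_aer => //; exact: integ_vol.
apply: scalar_eq.
- rewrite (re_convL1 s (V u) v) (re_convL1 s u (V v)).
  rewrite (Hl _ _ _ (integ_reL1 u) (integ_reL1 (V u)) (integ_reL1 v) (reL1_V
    u)).
  rewrite (Hl _ _ _ (integ_imL1 u) (integ_imL1 (V u)) (integ_imL1 v) (imL1_V
    u)).
  rewrite (Hr _ _ _ (integ_reL1 u) (integ_reL1 (V v)) (integ_reL1 v) (reL1_V
    v)).
  by rewrite (Hr _ _ _ (integ_imL1 u) (integ_imL1 (V v)) (integ_imL1 v) (imL1_V
    v)).
- rewrite (im_convL1 s (V u) v) (im_convL1 s u (V v)).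
  rewrite (Hl _ _ _ (integ_reL1 u) (integ_reL1 (V u)) (integ_imL1 v) (reL1_V
    u)).
  rewrite (Hl _ _ _ (integ_imL1 u) (integ_imL1 (V u)) (integ_reL1 v) (imL1_V
    u)).
  rewrite (Hr _ _ _ (integ_reL1 u) (integ_imL1 (V v)) (integ_imL1 v) (imL1_V
    v)).
  by rewrite (Hr _ _ _ (integ_imL1 u) (integ_reL1 (V v)) (integ_reL1 v) (reL1_V
    v)).
Qed.

(** Pairing with 1 gives the second primitive of [u], and taking primitives is injective. *)
Lemma convL1_oneL1_inj u : (forall s, convL1 s u oneL1 = 0) -> u = 0.
Proof.
move=> C0.
have i1 : integ (fun=> 1 : R) by exact: integ_cst.
have i0 : integ (fun=> 0 : R) by exact: integ_cst.
have E1 f s : integ f -> conv s f (reL1 oneL1) = vol (vol f) (Num.min s 1).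
  by move=> i; rewrite (conv_aer s i _ i1 reL1_oneL1)// conv1.
have E0 f s : integ f -> conv s f (imL1 oneL1) = 0.
  by move=> i; rewrite (conv_aer s i _ i0 imL1_oneL1)// convC// conv0l.
have vv f : integ f -> (forall s, vol (vol f) (Num.min s 1) = 0) ->
  aeq f (fun=> 0).
  move=> i H; apply: vol_inj => //; apply: vol_inj; first exact: integ_vol.
  by apply: ae_leb01 => x; rewrite in_itv /= => /andP[_ x1];
    rewrite -(H x) min_l.
apply: L1_eq.
- apply: aeq_trans (aeq_sym reL10); apply: vv => // s.
  by have := congr1 re (C0 s); rewrite re_convL1 E1// E0// subr0 re0.
- apply: aeq_trans (aeq_sym imL10); apply: vv => // s.
  by have := congr1 im (C0 s); rewrite im_convL1 E0// E1// add0r im0.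
Qed.

Lemma convL1_nrmL1 s u v : modulus (convL1 s u v) <= 4%:R * nrmL1 u * nrmL1 v.
Proof.
apply: le_trans (modulus_le _) _; rewrite re_convL1 im_convL1.
have Nu := nrmL1_ge0 u; have Nv := nrmL1_ge0 v.
have H f g : integ f -> integ g -> \int[mu]_t `|f t| <= nrmL1 u ->
    \int[mu]_t `|g t| <= nrmL1 v -> `|conv s f g| <= nrmL1 u * nrmL1 v.
  move=> i1 i2 h1 h2; apply: le_trans (conv_norm s i1 i2) _.
  by apply: ler_pM => //; exact: int01_ge0.
have := H _ _ (integ_reL1 u) (integ_reL1 v) (reL1_nrmL1 u) (reL1_nrmL1 v).
have := H _ _ (integ_reL1 u) (integ_imL1 v) (reL1_nrmL1 u) (imL1_nrmL1 v).
have := H _ _ (integ_imL1 u) (integ_reL1 v) (imL1_nrmL1 u) (reL1_nrmL1 v).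
have := H _ _ (integ_imL1 u) (integ_imL1 v) (imL1_nrmL1 u) (imL1_nrmL1 v).
move: (conv s (reL1 u) (reL1 v)) (conv s (reL1 u) (imL1 v)) (conv s (imL1 u)
  (reL1 v)) (conv s (imL1 u) (imL1 v)).
move=> a b c d h1 h2 h3 h4.
have := ler_normB a d; have := ler_normD b c; lra.
Qed.

End L1Volterra.

(** The [K[V]]-submodule generated by the family, presented so that inductions need no polynomials
    in [V]. Zero is obtained from a generator, which is why the lemmas below take an index. *)
Inductive vspan (K : numFieldType) (X : lmodType K) (V : X -> X) (I : Type)
    (v : I -> X) : X -> Prop :=
| vspan_gen i : vspan V v (v i)
| vspan_ZD a x y : vspan V v x -> vspan V v y -> vspan V v (a *: x + y)
| vspan_V x : vspan V v x -> vspan V v (V x).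

Section VSpan.
Context (K : numFieldType) (X : lmodType K) (V : X -> X).
Context (J : Type) (v : J -> X) (j0 : J).
Implicit Types (u w : X) (a : K).

Lemma vspan_0 : vspan V v 0.
Proof.
by have := vspan_ZD (-1) (vspan_gen V v j0) (vspan_gen V v j0);
  rewrite scaleN1r addNr.
Qed.

Lemma vspan_Z a u : vspan V v u -> vspan V v (a *: u).
Proof. by move=> su; rewrite -[_ *: _]addr0; apply: vspan_ZD => //;
  exact: vspan_0. Qed.

Lemma vspan_add u w : vspan V v u -> vspan V v w -> vspan V v (u + w).
Proof. by move=> su sw; rewrite -[u]scale1r; exact: vspan_ZD. Qed.

Lemma vspan_iter m u : vspan V v u -> vspan V v (iter m V u).
Proof. by move=> su; elim: m => //= m; exact: vspan_V. Qed.

Lemma vspan_sum (A : finType) (P : pred A) (f : A -> X) :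
  (forall i, P i -> vspan V v (f i)) -> vspan V v (\sum_(i | P i) f i).
Proof.
by move=> fP; elim/big_ind: _ => //; [exact: vspan_0|exact: vspan_add].
Qed.

End VSpan.

(** * Density of the [K[V]]-span of 1, and quasinilpotence of [V] *)

Section L1VolterraNorm.
Local Open Scope quotient_scope.
Context (R : realType) (k : scalar_kind).
Local Notation K := (Defs.scalar R k).
Local Notation mu := (leb01 R).
Local Notation X := (L1 k mu).
Local Notation V := (@volterra R k).
Local Notation mulX01 := (@mulX01 R k).
Local Notation oneL1 := (oneL1 R k).
Implicit Types (u v w : X) (a : K).
#[local] Hint Resolve integ_reL1 integ_imL1 : core.

Lemma of_real_nat n : of_real n%:R = n%:R :> K.
Proof.
elim: n => [|n IH]; first by rewrite of_real0.
rewrite -!natr1 of_realD IH; congr (_ + _).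
by rewrite /of_real; case: k.
Qed.

Lemma convL1_bound s u v : `|convL1 s u v| <= 4%:R * `|u| * `|v| :> K.
Proof.
rewrite -of_real_modulus !normE -of_real_nat -!of_realM of_real_le.
exact: convL1_nrmL1.
Qed.

Lemma mulX01_bound u : `|mulX01 u| <= 2%:R * `|u| :> K.
Proof. rewrite !normE -of_real_nat -of_realM of_real_le; exact: mulX01_nrmL1.
Qed.

Lemma reN1 : re (-1 : K) = -1. Proof. by case: k. Qed.
Lemma imN1 : im (-1 : K) = 0. Proof. by case: k => //=; rewrite oppr0. Qed.

Let oneL1_span := vspan V (fun _ : unit => oneL1).

(** The rules for D 1 and D V keep the derivation inside the [K[V]]-module of 1, which therefore
    contains every polynomial in t. *)
Lemma vspan_mulX01 w : oneL1_span w -> oneL1_span (mulX01 w).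
Proof.
elim=> [[]|a x y _ ix _ iy|x hx ix].
- by rewrite mulX01_oneL1; apply: vspan_V; exact: (vspan_gen _ _ tt).
- by rewrite mulX01_lin; exact: vspan_ZD.
- rewrite mulX01_V -[V (mulX01 x)]scale1r; apply: vspan_ZD;
    first exact: vspan_V.
  by apply: vspan_V; exact: vspan_V.
Qed.

Lemma vspan_poly (p : {poly R}) : exists w,
  [/\ oneL1_span w, aeq (reL1 w) (fun t =>
    p.[clip t]) & aeq (imL1 w) (fun=> 0)].
Proof.
elim/poly_ind: p => [|p c [w [sw rw iw]]].
  exists 0; split; [exact: (vspan_0 _ _ tt)| |exact: imL10].
  by apply: aeq_trans (reL10 _ _) _; apply: aeq_pt => t; rewrite horner0.
exists (of_real c *: oneL1 + mulX01 w); split.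
- by apply: vspan_ZD (vspan_mulX01 sw); exact: (vspan_gen _ _ tt).
- apply: aeq_trans (reL1_lin _ _ _) _.
  have H := ae01S2 (fun t e1 e2 => conj e1 e2) (reL1_oneL1 R k) (reL1_mulX01 w).
  apply: ae01S2 H rw => t [-> ->] ->.
  rewrite re_mk (_ : im (of_real c : K) = 0) ?im_mk// mul0r subr0 mulr1.
  by rewrite hornerMXaddC addrC.
- apply: aeq_trans (imL1_lin _ _ _) _.
  have H := ae01S2 (fun t e1 e2 => conj e1 e2) (imL1_oneL1 R k) (imL1_mulX01 w).
  apply: ae01S2 H iw => t [-> ->] ->.
  by rewrite (_ : im (of_real c : K) = 0) ?im_mk// mulr0 !mul0r !addr0.
Qed.

Lemma reL1B u w : aeq (reL1 (- 1 *: w + u)) (fun t => reL1 u t - reL1 w t).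
Proof.
apply: aeq_trans (reL1_lin _ _ _) _; apply: aeq_pt => t.
by rewrite reN1 imN1 mul0r subr0 mulN1r addrC.
Qed.

Lemma imL1B u w : aeq (imL1 (- 1 *: w + u)) (fun t => imL1 u t - imL1 w t).
Proof.
apply: aeq_trans (imL1_lin _ _ _) _; apply: aeq_pt => t.
by rewrite reN1 imN1 mul0r addr0 mulN1r addrC.
Qed.

Lemma vspan_dense u (e : R) : 0 < e ->
  exists2 w, oneL1_span w & nrmL1 (u - w) <= e.
Proof.
move=> e0; have e2 : 0 < e / 2 by rewrite divr_gt0.
have [_ /(_ _ e2)[p up]] := poly_dense (integ_reL1 u).
have [_ /(_ _ e2)[q uq]] := poly_dense (integ_imL1 u).
have [wp [sp rwp iwp]] := vspan_poly p.
have [wq [sq rwq iwq]] := vspan_poly q.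
(* The scalar is i over the complex numbers and 0 over the reals, where there is no imaginary part
   to approximate. *)
exists (mk_scalar 0 1 *: wq + wp); first exact: vspan_ZD.
set w := _ + wp.
have -> : u - w = - 1 *: w + u by rewrite scaleN1r addrC.
have rw : aeq (reL1 w) (fun t => p.[clip t]).
  apply: aeq_trans (reL1_lin _ _ _) _.
  have H := ae01S2 (fun t e1 e2 => conj e1 e2) rwp iwq.
  by apply: ae01S H => t [-> ->]; rewrite re_mk mul0r mulr0 subr0 add0r.
apply: le_trans (nrmL1_le _) _; rewrite [e]splitr; apply: lerD.
  apply: le_trans up; rewrite (@int_abs_ae _ _ (fun t =>
    reL1 u t - p.[clip t]))//.
    by apply: integB => //; exact: integ_poly.
  apply: aeq_trans (reL1B _ _) _; apply: ae01S rw => t -> //.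
have [kR|kC] : k = RealScalars \/ k = ComplexScalars by case: k; [left|right].
  rewrite imL1_real//; under eq_Rintegral do rewrite normr0.
  by rewrite int01_cst ltW.
have iw : aeq (imL1 w) (fun t => q.[clip t]).
  apply: aeq_trans (imL1_lin _ _ _) _.
  have H := ae01S2 (fun t e1 e2 => conj e1 e2) rwq iwp.
  apply: ae01S H => t [-> ->].
  by rewrite re_mk mul0r add0r im_mk ?mul1r ?addr0// kC.
apply: le_trans uq; rewrite (@int_abs_ae _ _ (fun t =>
  imL1 u t - q.[clip t]))//.
  by apply: integB => //; exact: integ_poly.
by apply: aeq_trans (imL1B _ _) _; apply: ae01S iw => t ->.
Qed.

Lemma oneL1_dense u (e : K) : 0 < e ->
  exists2 w, oneL1_span w & `|u - w| <= e :> K.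
Proof.
move=> e0; have ee : e = of_real (re e).
  apply: scalar_eq; first by rewrite re_mk.
  rewrite im_mk//; move: e e0; rewrite /im; case: k => //= e.
  by rewrite ltcE /= => /andP[/eqP].
have r0 : 0 < re e.
  rewrite lt_neqAle -(@of_real_le R k) of_real0 -ee (ltW e0) andbT.
  apply/eqP => r0; move: e0; rewrite ee -r0 of_real0 ltxx//.
have [w sw uw] := vspan_dense u r0; exists w => //.
by rewrite ee normE of_real_le.
Qed.

(** Up to a factor, the L^1 norm of [u] on [0, x]. *)
Let N (x : R) u := vol (fun t => `|reL1 u t|) x + vol (fun t => `|imL1 u t|) x.

Let N_ge0 x u : 0 <= N x u.
Proof. by apply: addr_ge0; exact: vol_norm_ge0. Qed.

Lemma vol_abs_ae (f g : R -> R) x : integ f -> integ g -> aeq f g ->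
  vol (fun t => `|f t|) x = vol (fun t => `|g t|) x.
Proof.
move=> i1 i2 fg; apply: vol_ae; [exact: integ_abs|exact: integ_abs|].
by apply: ae01S fg => t ->.
Qed.

Let N_V (a b : R) u : 0 <= a -> a <= b -> b <= 1 ->
  N b (V u) <= N a u + (b - a) * N b u.
Proof.
move=> a0 ab b1; rewrite /N mulrDr addrACA; apply: lerD.
- rewrite (vol_abs_ae _ _ _ (reL1_V u))//; last exact: integ_vol.
  exact: vol_norm_vol.
- rewrite (vol_abs_ae _ _ _ (imL1_V u))//; last exact: integ_vol.
  exact: vol_norm_vol.
Qed.

Lemma vol_abs_lin (f g h l : R -> R) (a b : R) x : integ f -> integ g ->
  integ h -> integ l ->
  aeq l (fun t => a * f t + b * g t + h t) ->
  vol (fun t => `|l t|) x <= `|a| * vol (fun t => `|f t|) x +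
    `|b| * vol (fun t => `|g t|) x + vol (fun t => `|h t|) x.
Proof.
move=> i1 i2 i3 i4 E; have il := integ_lin' a b i1 i2 i3.
have af := integ_abs i1; have ag := integ_abs i2; have ah := integ_abs i3.
rewrite (vol_abs_ae _ i4 il E) -!volZ//.
rewrite -volD; [|exact: integZ|exact: integZ].
rewrite -volD//; last by apply: integD; exact: integZ.
rewrite !volE; apply: int01_le.
- exact/integ_lec/integ_abs.
- by apply: integ_lec; apply: integD => //; apply: integD; exact: integZ.
move=> t _; rewrite ler_wpM2r// -!normrM.
apply: le_trans (ler_normD _ _) _; rewrite lerD2r; exact: ler_normD.
Qed.

Let N_lin x a u v : N x (a *: u + v) <= (`|re a| + `|im a|) * N x u + N x v.
Proof.
have arith (A B p q r s m l : R) : A <= m * p + l * q + r ->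
    B <= m * q + l * p + s -> A + B <= (m + l) * (p + q) + (r + s) by lra.
have H1 := @vol_abs_lin _ _ _ _ (re a) (- im a) x (integ_reL1 u) (integ_imL1 u)
  (integ_reL1 v) (integ_reL1 (a *: u + v)).
have H2 := @vol_abs_lin _ _ _ _ (re a) (im a) x (integ_imL1 u) (integ_reL1 u)
  (integ_imL1 v) (integ_imL1 (a *: u + v)).
have E : aeq (reL1 (a *: u + v)) (fun t =>
  re a * reL1 u t + - im a * imL1 u t + reL1 v t).
  by apply: aeq_trans (reL1_lin _ _ _) _; apply: aeq_pt => t; rewrite mulNr.
move: (H1 E); rewrite normrN => H1E; exact: arith H1E (H2 (imL1_lin a u v)).
Qed.

Let N0 u : N 0 u = 0.
Proof. by rewrite /N !volE_lam ?ler01// set_itv1 !Rintegral_set1 addr0. Qed.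

Let N1_eq0 u : N 1 u = 0 -> u = 0.
Proof.
move=> Nu; apply: (@normr0_eq0 _ X).
have E f : integ f -> vol (fun t => `|f t|) 1 = \int[mu]_t `|f t|.
  move=> i; rewrite volE; apply: eq_Rintegral01 => t;
    rewrite in_itv /= => /andP[_ t1].
  by rewrite t1 mulr1.
rewrite normE (_ : nrmL1 u = 0) ?of_real0//.
apply/eqP; rewrite eq_le nrmL1_ge0 andbT -Nu /N !E//; exact: nrmL1_le.
Qed.

(** The constant must not depend on [x]. Applying [V] costs nothing, by the estimate of [N_V] with a
    = 0. *)
Let N_span n (v : 'I_n -> X) w : vspan V v w ->
  exists2 c : R, 0 <= c & forall x, 0 <= x <= 1 ->
    N x w <= c * \sum_i N x (v i).
Proof.
have S0 x : 0 <= \sum_i N x (v i) by apply: sumr_ge0 => i _; exact: N_ge0.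
elim=> [i|a x y _ [c c0 cP] _ [d d0 dP]|x _ [c c0 cP]].
- exists 1 => // x _; rewrite mul1r (bigD1 i)//= lerDl.
  by apply: sumr_ge0 => j _; exact: N_ge0.
- exists ((`|re a| + `|im a|) * c + d);
    first by rewrite addr_ge0// mulr_ge0// addr_ge0.
  move=> t t01; apply: le_trans (N_lin _ _ _ _) _.
  rewrite [leRHS]mulrDl -[X in _ <= X + _]mulrA; apply: lerD; last exact: dP.
  by apply: ler_wpM2l; [rewrite addr_ge0|exact: cP].
- exists c => // t t01; apply: le_trans (cP t t01); case/andP: t01 => t0 t1.
  apply: le_trans (N_V _ (lexx 0) t0 t1) _; rewrite N0 add0r subr0.
  by rewrite ler_piMl.
Qed.

(* Nakayama's lemma for the quasinilpotent operator [V]. *)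
Lemma volterra_nakayama n (v : 'I_n -> X) :
  (forall i, exists2 w, vspan V v w & v i = V w) -> forall i, v i = 0.
Proof.
move=> vw; have /choice[w wP] : forall i, exists w, vspan V v w /\ v i = V w.
  by move=> i; have [w] := vw i; exists w.
have /choice[c cP] : forall i, exists c : R, 0 <= c /\
    forall x, 0 <= x <= 1 -> N x (w i) <= c * \sum_i N x (v i).
  by move=> i; have [c c0 cP] := N_span (wP i).1; exists c.
pose S x := \sum_i N x (v i); pose cc := \sum_i c i.
have S0 x : 0 <= S x by apply: sumr_ge0 => i _; exact: N_ge0.
have cc0 : 0 <= cc by apply: sumr_ge0 => i _; have [] := cP i.
(* Each generator is [V] of a combination of the generators, so the short-interval estimate closes
   up on the sum [S]. *)
have step (a b : R) : 0 <= a -> a <= b -> b <= 1 ->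
  S b <= cc * S a + cc * (b - a) * S b.
  move=> a0 ab b1.
  have -> : cc * S a + cc * (b - a) * S b = \sum_i (c i * S a + (b - a) * (c i
    * S b)).
    rewrite big_split /= -mulr_sumr -!mulr_suml -/cc; congr (_ + _).
    by rewrite mulrA [cc * _]mulrC.
  apply: ler_sum => i _; rewrite {1}(wP i).2;
    apply: le_trans (N_V _ a0 ab b1) _.
  have [_ ci] := cP i; apply: lerD; first by apply: ci;
    rewrite a0 (le_trans ab).
  by apply: ler_wpM2l; [rewrite subr_ge0|apply: ci; rewrite (le_trans a0)].
(* On steps of length 1/M the factor [cc * (b - a)] is at most 1/2 and is absorbed on the left; [S]
   then vanishes successively along the grid from 0 to 1. *)
have [M Mcc] : exists M : nat, 2 * cc < M%:R.
  exists (Num.truncn (2 * cc)).+1; rewrite truncnS_gt//.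
have M0 : 0 < M%:R :> R by rewrite (le_lt_trans _ Mcc)// mulr_ge0.
have SM j : (j <= M)%N -> S (j%:R / M%:R) = 0.
  elim: j => [_|j IH jM].
    by rewrite mul0r; apply: big1 => i _; exact: N0.
  have := step (j%:R / M%:R) (j.+1%:R / M%:R).
  rewrite IH ?(ltnW jM)// mulr0 add0r divr_ge0// ler_pM2r ?invr_gt0// ler_nat
    leqnSn.
  rewrite ler_pdivrMr// mul1r ler_nat jM -mulrBl -natrB// subSnn =>
    /(_ erefl erefl erefl).
  move=> H; apply/eqP; rewrite eq_le S0 andbT.
  have h : cc * (1 / M%:R) <= 1 / 2 by rewrite mulrA mulr1 ler_pdivrMr//; lra.
  have := ler_wpM2r (S0 (j.+1%:R / M%:R)) h.
  by move: H (S0 (j.+1%:R / M%:R)) => *; lra.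
have := SM M (leqnn M); rewrite divff ?gt_eqF// => S1 i.
apply: N1_eq0; apply/eqP; rewrite eq_le N_ge0 andbT -S1 /S (bigD1 i)//= lerDl.
by apply: sumr_ge0 => j _; exact: N_ge0.
Qed.

Lemma oneL1_neq0 : oneL1 != 0.
Proof.
apply/eqP => one0.
have := reL10 R k; rewrite -one0 => r0.
have := @int01_ae _ _ _ (integ_cst 1) (integ_cst 0) (aeq_trans (aeq_sym
  (reL1_oneL1 R k)) r0).
by rewrite !int01_cst => /eqP; rewrite oner_eq0.
Qed.

End L1VolterraNorm.

(** * Linear independence detected by determinants *)

Lemma cvg_det (K : numFieldType) (T : Type) (F : set_system T) (FF : Filter F)
    n (M : T -> 'M[K^o]_n) (A : 'M[K^o]_n) :
  (forall i j, M x i j @[x --> F] --> A i j) ->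
  \det (M x) @[x --> F] --> \det A.
Proof.
move=> MA; rewrite /determinant.
apply: cvg_big => [|s _]; first exact: add_continuous.
apply: cvgM; first exact: cvg_cst.
apply: cvg_big => [|i _]; first exact: mul_continuous.
exact: MA.
Qed.

Lemma open_neq0 (K : numFieldType) (T : topologicalType) (f : T -> K^o) :
  continuous f -> open [set y | f y != 0].
Proof. by move=> cf; rewrite openE => y /= fy; exact: (cvgr_neq0 _ (cf y) fy).
Qed.

(** Induction on the number of functions. With all sample points but the last fixed, expansion along
    the last column is a combination of the [F i] in the remaining point t. Its last coefficient is,
    up to sign, the minor given by induction, so freeness excludes that it vanishes for all t. *)
Lemma free_det_neq0 (K : fieldType) (I : Type) r (F : 'I_r -> I -> K) :
  (forall c : 'I_r -> K, (forall s, \sum_i c i * F i s = 0) ->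
    forall i, c i = 0) ->
  exists s : 'I_r -> I, \det (\matrix_(i, j) F i (s j)) != 0.
Proof.
elim: r F => [|r IH] F freeF.
  have e : 'I_0 -> I by case.
  by exists e; rewrite det_mx00 oner_eq0.
have [c ci|s ds] := IH (fun i => F (widen_ord (leqnSn r) i)).
  have := freeF (fun i => if unlift ord_max i is Some j then c j else 0).
  move=> H i; have := H _ (widen_ord (leqnSn r) i).
  have -> : widen_ord (leqnSn r) i = lift ord_max i by apply: val_inj;
    rewrite /= /bump leqNgt ltn_ord.
  rewrite liftK; apply => t; rewrite big_ord_recr /= unlift_none mul0r addr0.
  transitivity (\sum_i c i * F (widen_ord (leqnSn r) i) t); last exact: ci.
  apply: eq_bigr => j _.
  have -> : widen_ord (leqnSn r) j = lift ord_max j by apply: val_inj;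
    rewrite /= /bump leqNgt ltn_ord.
  by rewrite liftK.
pose M t := \matrix_(i, j) F i (if unlift ord_max j is Some j' then s j' else
  t).
pose cof (i : 'I_r.+1) := (-1) ^+ (i + r) * \det (\matrix_(i' < r,
  j < r) F (lift i i') (s j)).
have detM t : \det (M t) = \sum_i cof i * F i t.
  rewrite (expand_det_col _ ord_max); apply: eq_bigr => i _.
  rewrite mxE unlift_none mulrC /cofactor; congr (_ * \det _ * _).
  by apply/matrixP => i' j; rewrite !mxE liftK.
have [t Mt] : exists t, \det (M t) != 0.
  apply: contrapT => /forallNP all0.
  have := freeF cof _ ord_max.
  move=> H; have : cof ord_max = 0.
    by apply: H => t; rewrite -detM; have := all0 t; move/negP;
      rewrite negbK => /eqP.
  apply/eqP; rewrite mulf_neq0 ?signr_eq0//.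
  rewrite (_ : (\matrix_(i', j) _) = \matrix_(i,
    j) F (widen_ord (leqnSn r) i) (s j))//.
  apply/matrixP => i j; rewrite !mxE; congr (F _ _).
  by apply: val_inj; rewrite /= /bump leqNgt ltn_ord.
by exists (fun j => if unlift ord_max j is Some j' then s j' else t).
Qed.

Section Span.
Context (K : fieldType) (X : lmodType K).

(** Dependent vectors are removed one at a time. A free family is needed because the determinant
    test below must not vanish identically. *)
Lemma free_family n (e : 'I_n -> X) : exists r (f : 'I_r -> X),
  (forall c : 'I_r -> K, \sum_i c i *: f i = 0 -> forall i, c i = 0) /\
  (forall c : 'I_n -> K, exists d : 'I_r ->
    K, \sum_i c i *: e i = \sum_i d i *: f i).
Proof.
elim: n e => [|n IH] e.
  exists 0%N, e; split; first by move=> c _ [].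
  by move=> c; exists c.
have [fr|] := pselect (forall c : 'I_n.+1 -> K, \sum_i c i *: e i = 0 ->
  forall i, c i = 0).
  by exists n.+1, e; split => // c; exists c.
move=> /existsNP[c] /not_implyP[ce /existsNP[l /eqP cl]].
have [r [f [fr fs]]] := IH (fun j => e (lift l j)); exists r, f; split=> // d.
have el : e l = \sum_j (- (c l)^-1 * c (lift l j)) *: e (lift l j).
  rewrite [RHS](_ : _ = - (c l)^-1 *: (\sum_j c (lift l j) *: e (lift l j)));
    last first.
    by rewrite scaler_sumr; apply: eq_bigr => j _; rewrite scalerA.
  move: ce; rewrite (bigD1_ord l)//= => /eqP; rewrite addrC addr_eq0 => /eqP ->.
  by rewrite scalerN scaleNr opprK scalerA mulVf// scale1r.
have [d' dd'] := fs (fun j => d l * (- (c l)^-1 * c (lift l j)) + d (lift l j)).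
exists d'; rewrite -dd' (bigD1_ord l)//= el scaler_sumr -big_split /=.
by apply: eq_bigr => j _; rewrite scalerDl scalerA.
Qed.

End Span.

(** * Multipliers *)

Section VolterraAlgebra.
Context (K : numFieldType) (X : normedModType K) (I : Type).
(** [C s u v] stands for the s-th of a separating family of functionals applied to the product of
    [u] and [v]; [V] is multiplication by [one], and [D] a derivation. *)
Variables (V D : X -> X) (one : X) (C : I -> X -> X -> K).

Definition lin (S : X -> X) := forall a u v, S (a *: u + v) = a *: S u + S v.
Definition bounded (S : X -> X) :=
  exists2 M : K, 0 <= M & forall u, `|S u| <= M * `|u|.

Hypotheses (V_lin : lin V) (D_lin : lin D) (D_bd : bounded D).
Hypothesis C_linl : forall s v a u w,
  C s (a *: u + w) v = a * C s u v + C s w v.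
Hypothesis C_sym : forall s u v, C s u v = C s v u.
Hypothesis C_V : forall s u v, C s (V u) v = C s u (V v).
Hypothesis C_bd : forall s v, exists2 M : K, 0 <= M & forall u,
  `|C s u v| <= M * `|u|.
Hypothesis C_one : forall u, (forall s, C s u one = 0) -> u = 0.
Hypothesis V_inj : forall u, V u = 0 -> u = 0.
Hypothesis D_V : forall u, D (V u) = V (D u) + V (V u).
Hypothesis D_one : D one = V one.
Hypothesis one_neq0 : one != 0.
Hypothesis one_dense : forall u (e : K), 0 < e ->
  exists2 w, vspan V (fun _ : unit => one) w & `|u - w| <= e.
Hypothesis nakayama : forall n (v : 'I_n -> X),
  (forall i, exists2 w, vspan V v w & v i = V w) -> forall i, v i = 0.

Implicit Types (S T : X -> X) (u v w : X) (a : K).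

Lemma lin0 S : lin S -> S 0 = 0.
Proof. by move=> linS; have := linS (-1) 0 0;
  rewrite scaler0 addr0 scaleN1r addNr. Qed.

Lemma linZ S a u : lin S -> S (a *: u) = a *: S u.
Proof. by move=> linS; have := linS a u 0; rewrite (lin0 linS) !addr0. Qed.

Lemma linD S u v : lin S -> S (u + v) = S u + S v.
Proof. by move=> linS; have := linS 1 u v; rewrite !scale1r. Qed.

Lemma linB S u v : lin S -> S (u - v) = S u - S v.
Proof. by move=> linS; rewrite addrC -scaleN1r linS scaleN1r addrC. Qed.

Lemma linN S u : lin S -> S (- u) = - S u.
Proof. by move=> linS; rewrite -scaleN1r linZ// scaleN1r. Qed.

Lemma lin_sum S n (c : 'I_n -> K) (e : 'I_n -> X) : lin S ->
  S (\sum_i c i *: e i) = \sum_i c i *: S (e i).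
Proof.
move=> linS; elim: n c e => [|n IH] c e; first by rewrite !big_ord0 lin0.
by rewrite !big_ord_recl linS IH.
Qed.

Lemma C0l s v : C s 0 v = 0.
Proof. by have := C_linl s v (-1) 0 0; rewrite scaler0 addr0 mulN1r addNr. Qed.

Lemma C_linr s v a u w : C s v (a *: u + w) = a * C s v u + C s v w.
Proof. by rewrite !(C_sym s v) C_linl. Qed.

Lemma C_suml s v n (c : 'I_n -> K) (e : 'I_n -> X) :
  C s (\sum_i c i *: e i) v = \sum_i c i * C s (e i) v.
Proof.
elim: n c e => [|n IH] c e; first by rewrite !big_ord0 C0l.
by rewrite !big_ord_recl C_linl IH.
Qed.

Lemma C_Dl s v u w : C s (u + w) v = C s u v + C s w v.
Proof. by have := C_linl s v 1 u w; rewrite scale1r mul1r. Qed.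

Lemma C_Zl s v a u : C s (a *: u) v = a * C s u v.
Proof. by have := C_linl s v a u 0; rewrite C0l !addr0. Qed.

Lemma C_one_eq u v : (forall s, C s u one = C s v one) -> u = v.
Proof.
move=> uv; apply/eqP; rewrite -subr_eq0; apply/eqP; apply: C_one => s.
by rewrite C_Dl uv -scaleN1r C_Zl mulN1r subrr.
Qed.

Definition multiplier S := [/\ lin S, bounded S & forall u, S (V u) = V (S u)].

Lemma bounded_comp S T : bounded S -> bounded T -> bounded (fun u => S (T u)).
Proof.
move=> [M M0 SM] [N N0 TN]; exists (M * N); first exact: mulr_ge0.
by move=> u; apply: le_trans (SM _) _; rewrite -mulrA ler_wpM2l.
Qed.

Lemma multiplier_id : multiplier id.
Proof. by split => //; exists 1 => // u; rewrite mul1r. Qed.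

Lemma multiplier_comp S T : multiplier S -> multiplier T ->
  multiplier (fun u => S (T u)).
Proof.
move=> [lS bS cS] [lT bT cT]; split; first by move=> a u v; rewrite lT lS.
- exact: bounded_comp.
- by move=> u; rewrite cT cS.
Qed.

(* [D] is a derivation, so its commutator with a multiplier is a multiplier. *)
Definition brac S u := D (S u) - S (D u).

Lemma multiplier_brac S : multiplier S -> multiplier (brac S).
Proof.
move=> [lS bS cS]; split.
- move=> a u v; rewrite /brac lS !D_lin lS scalerBr opprD !addrA; congr (_ - _).
  by rewrite addrAC.
- have [M M0 DS] := bounded_comp D_bd bS;
    have [N N0 SD] := bounded_comp bS D_bd.
  exists (M + N); first exact: addr_ge0.
  by move=> u; apply: le_trans (ler_normB _ _) _; rewrite mulrDl lerD.
- move=> u; rewrite /brac cS !D_V (linD _ _ lS) !cS (linB _ _ V_lin).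
  by rewrite opprD addrACA subrr addr0.
Qed.

Lemma functional_eq0 (phi : X -> K) :
  (forall a u v, phi (a *: u + v) = a * phi u + phi v) ->
  (exists2 M : K, 0 <= M & forall u, `|phi u| <= M * `|u|) ->
  (forall w, vspan V (fun _ : unit => one) w -> phi w = 0) ->
    forall u, phi u = 0.
Proof.
move=> lphi [M M0 phiM] phi0 u; apply/eqP; rewrite -normr_eq0;
  apply: contraT => pu.
have pu0 : 0 < `|phi u| by rewrite lt_neqAle eq_sym pu normr_ge0.
have M1 : 0 < M + 1 by rewrite ltr_wpDl.
(* This precision yields |phi u| <= |phi u| / 2; the [+ 1] covers M = 0. *)
have e0 : 0 < `|phi u| / 2 / (M + 1) by rewrite !divr_gt0.
have [w sw uw] := one_dense u e0.
have E : phi (u - w) = phi u by rewrite addrC -scaleN1r lphi (phi0 _ sw) mulr0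
  add0r.
have : `|phi u| <= `|phi u| / 2.
  rewrite -{1}E; apply: le_trans (phiM _) _;
    apply: le_trans (ler_wpM2l M0 uw) _.
  rewrite mulrCA ler_piMr ?divr_ge0 ?(ltW pu0)//.
  by rewrite ler_pdivrMr// mul1r lerDl.
by rewrite ler_pdivlMr// mulr_natr mulr2n gerDl (lt_geF pu0).
Qed.

Lemma C_brM_bd S s v : bounded S ->
  exists2 M : K, 0 <= M & forall u, `|C s (S u) v| <= M * `|u|.
Proof.
move=> [M M0 SM]; have [N N0 CN] := C_bd s v.
exists (N * M); first exact: mulr_ge0.
by move=> u; apply: le_trans (CN _) _; rewrite -mulrA ler_wpM2l.
Qed.

(** Two density arguments: first [u] is [one] and [v] runs over the [K[V]]-span of [one], then [v]
    is arbitrary and [u] runs over that span. *)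
Lemma multiplier_C T s u v : multiplier T -> C s (T u) v = C s u (T v).
Proof.
move=> mT; have [lT bT cT] := mT.
have bdsub (f g : X -> K) : (exists2 M : K, 0 <= M & forall u,
  `|f u| <= M * `|u|) ->
    (exists2 M : K, 0 <= M & forall u, `|g u| <= M * `|u|) ->
    exists2 M : K, 0 <= M & forall u, `|f u - g u| <= M * `|u|.
  move=> [M M0 fM] [N N0 gN]; exists (M + N); first exact: addr_ge0.
  by move=> w; apply: le_trans (ler_normB _ _) _; rewrite mulrDl lerD.
have cTi j w : T (iter j V w) = iter j V (T w) by elim: j => //= j <-;
  rewrite cT.
have CVi j w w' t : C t (iter j V w) w' = C t w (iter j V w').
  by elim: j w w' => //= j IH w w'; rewrite C_V IH -iterSr.
have T1 t w : C t (T one) w = C t one (T w).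
  apply/eqP; rewrite -subr_eq0; apply/eqP; move: w.
  apply: functional_eq0.
  - move=> a x y; rewrite C_linr lT C_linr; ring.
  - apply: bdsub.
      by have [M M0 h] := C_bd t (T one); exists M => // x; rewrite C_sym.
    by have [M M0 h] := C_brM_bd t one bT; exists M => // x; rewrite C_sym.
  - move=> w sw; apply/eqP; rewrite subr_eq0; apply/eqP.
    (* Powers of [V] are allowed on the left so that, in the induction, a [V] in front of [w] can be
       carried over to the first argument. *)
    suff H j : C t (T (iter j V one)) w = C t (iter j V one) (T w) by exact: (H
      0%N).
    elim: sw j => [[]|a x y _ IHx _ IHy|x _ IH] j.
    + by rewrite cTi CVi C_sym.
    + by rewrite C_linr lT C_linr IHx IHy.
    + by rewrite -C_V -cT -iterS IH /= C_V cT.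
apply/eqP; rewrite -subr_eq0; apply/eqP; move: u v.
suff H u : forall v, C s (T u) v - C s u (T v) = 0 by exact: H.
move=> v; move: u; apply: functional_eq0.
- move=> a x y; rewrite lT !C_linl; ring.
- by apply: bdsub; [exact: C_brM_bd|exact: C_bd].
- move=> w sw; apply/eqP; rewrite subr_eq0; apply/eqP.
  elim: sw v => [[]|a x y _ IHx _ IHy|x _ IH] v.
  + exact: T1.
  + by rewrite lT !C_linl IHx IHy.
  + by rewrite cT C_V IH cT -C_V.
Qed.

(** Symmetry of [C] gives equality at [one]; moving both operators onto [one] extends it to every
    [u]. *)
Lemma multiplier_comm S T u : multiplier S -> multiplier T -> S (T u) = T (S u).
Proof.
move=> mS mT; have E s v w : C s (S (T v)) w = C s v (T (S w)).
  by rewrite multiplier_C// multiplier_C.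
have E' s v w : C s (T (S v)) w = C s v (S (T w)).
  by rewrite multiplier_C// multiplier_C.
have ST1 : S (T one) = T (S one).
  by apply: C_one_eq => s; rewrite E C_sym.
by apply: C_one_eq => s; rewrite E E' ST1.
Qed.

(** In the model V^m 1 = t^m / m!, and t^(m+1) / m! is m + 1 times t^(m+1) / (m+1)!. *)
Lemma D_iter m : D (iter m V one) = m.+1%:R *: iter m.+1 V one.
Proof.
elim: m => [|m IH]; first by rewrite D_one scale1r.
by rewrite [iter m.+1 V one]/= D_V IH (linZ _ _ V_lin) -[m.+2%:R]natr1 scalerDl
  scale1r.
Qed.

Lemma iter_lin m : lin (iter m V).
Proof. by elim: m => [|m IH] a u v //=; rewrite IH V_lin. Qed.

Lemma iter_inj m u : iter m V u = 0 -> u = 0.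
Proof. by elim: m => //= m IH /V_inj. Qed.

Lemma C_iter s m u v : C s (iter m V u) v = C s u (iter m V v).
Proof. by elim: m u v => //= m IH u v; rewrite C_V IH -iterSr. Qed.

(* Read as a convolution operator, [one] is [V] and [test m] is
   [V (1 + V ^ m.+1)], which is injective because [V] is quasinilpotent. *)
Definition test m := one + iter m.+1 V one.

Lemma C_test s m u : C s u (test m) = C s (u + iter m.+1 V u) one.
Proof. by rewrite /test C_sym C_Dl C_sym [X in _ + X]C_sym -C_iter -C_Dl. Qed.

(** Here u = V(- V^m u), so Nakayama applies to the single generator [u]. *)
Lemma id_iter_inj m u : u + iter m.+1 V u = 0 -> u = 0.
Proof.
move=> /eqP; rewrite addr_eq0 => /eqP uV.
apply: (nakayama (n := 1) (v := fun=> u)) (ord0) => _.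
exists (-1 *: iter m V u).
  apply: (vspan_Z ord0); apply: vspan_iter;
    exact: (vspan_gen _ (fun _ : 'I_1 => u) ord0).
by rewrite (linZ _ _ V_lin) scaleN1r.
Qed.

Lemma C_test_inj m u : (forall s, C s u (test m) = 0) -> u = 0.
Proof.
by move=> u0; apply: (@id_iter_inj m); apply: C_one => s; rewrite -C_test.
Qed.

Lemma D_test m : D (test m) = V one + m.+2%:R *: iter m.+2 V one.
Proof. by rewrite /test (linD _ _ D_lin) D_one D_iter. Qed.

(** Cancelling the common factor [one] leaves (1 + V^(m+1)) b = V p + (m+2) V^(m+2) p. Subtracting
    (1 + V^(m+1)) V p lowers m + 2 to m + 1, which is still nonzero. *)
Lemma test_eq m p b : (forall s, C s p (D (test m)) = C s b (test m)) ->
  (b - V p) + iter m.+1 V (b - V p) = m.+1%:R *: iter m.+2 V p.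
Proof.
move=> H; have {}H : b + iter m.+1 V b = V p + m.+2%:R *: iter m.+2 V p.
  apply: C_one_eq => s; rewrite -C_test -H D_test.
  rewrite C_sym C_Dl C_Zl C_sym -C_V [X in _ + _ * X]C_sym -C_iter.
  by rewrite -C_Zl -C_Dl.
rewrite (linB _ _ (iter_lin m.+1)) addrACA H -opprD -[iter m.+1 V (V p)]iterSr.
by rewrite opprD addrACA subrr add0r -[m.+2%:R]natr1 scalerDl scale1r addrK.
Qed.

(* Solving [p * D (test m) = b * test m] for [b] gives, up to the fixed vector
   [V p], elements [b j = V ^ (j + 3) (w j)] with [w j] a nonzero multiple of
     [p]
   modulo [V]. A linear relation between them would put [p] in the image under
   [V] of the finitely generated [K[V]]-module spanned by [p] and the [b j]. *)
Lemma test_independent p r (e : 'I_r -> X) : p != 0 ->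
  exists m, forall c : 'I_r -> K, exists s,
    C s p (D (test m)) != \sum_i c i * C s (e i) (test m).
Proof.
move=> p0; apply: contrapT => /forallNP H; apply/negP: p0; apply/negPn/eqP.
(* The value m = 0 is skipped. One substitution of the equation for [b] into itself leaves a
   remainder V^(2m+2) b, which has to lie in the image of V^(m+3); the exponents allow this for m >=
   1. *)
have {}H (j : 'I_r.+2) : exists c : 'I_r -> K, forall s,
    C s p (D (test j.+1)) = C s (\sum_i c i *: e i) (test j.+1).
  have /existsNP[c /forallNP cs] := H j.+1; exists c => s; rewrite C_suml.
  by apply/eqP; apply: contraT => /cs.
have [c cP] := choice H.
(* Column 0 records the coefficient of [V p] and the others those of the [e i]: r + 1 columns
   against r + 2 rows force a relation. *)
pose A : 'M[K]_(r.+2, r.+1) :=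
  \matrix_(j, i) if unlift ord0 i is Some i' then c j i' else -1.
pose b (j : 'I_r.+2) := \sum_i c j i *: e i - V p.
have bE j : b j + iter j.+2 V (b j) = j.+2%:R *: iter j.+3 V p by exact:
  test_eq (cP j).
have [l l0 lA] : exists2 l : 'rV[K]_r.+2, l != 0 & l *m A = 0.
  exists (nz_row (kermx A)); last first.
    by apply/eqP; rewrite -sub_kermx; exact: nz_row_sub.
  rewrite nz_row_eq0 -mxrank_eq0 mxrank_ker subn_eq0 -ltnNge ltnS.
  exact: rank_leq_col.
have lb : \sum_j l 0 j *: b j = 0.
  have col i : \sum_j l 0 j * A j i = 0 by have /matrixP/(_ 0 i) := lA;
    rewrite !mxE.
  transitivity (\sum_j (\sum_i (l 0 j * c j i) *: e i - l 0 j *: V p)).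
    apply: eq_bigr => j _; rewrite scalerBr scaler_sumr; congr (_ - _).
    by apply: eq_bigr => i _; rewrite scalerA.
  rewrite sumrB exchange_big /= big1 ?sub0r => [|i _]; last first.
    rewrite -scaler_suml; have := col (lift ord0 i).
    by under eq_bigr do rewrite mxE liftK; move=> ->; rewrite scale0r.
  rewrite -scaler_suml; have := col ord0.
  under eq_bigr do rewrite mxE unlift_none mulrN1.
  by rewrite sumrN => /eqP; rewrite oppr_eq0 => /eqP ->; rewrite scale0r oppr0.
pose v (i : 'I_r.+3) := if unlift ord0 i is Some j then b j else p.
have sa : vspan V v p by have := vspan_gen V v ord0; rewrite /v unlift_none.
have sb j : vspan V v (b j) by have := vspan_gen V v (lift ord0 j);
  rewrite /v liftK.
pose q (j : 'I_r.+2) := - (j.+2%:R *: iter j.+1 V p - iter j V (b j)).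
(* Obtained from b = (j+2) V^(j+3) p - V^(j+2) b, substituted once into itself, by factoring out
   V^(j+3). *)
pose w (j : 'I_r.+2) := j.+2%:R *: p + V (q j).
have sq j : vspan V v (q j).
  rewrite /q -scaleN1r; apply: (vspan_Z ord0); apply: (vspan_add).
    by apply: (vspan_Z ord0); exact: vspan_iter.
  by rewrite -scaleN1r; apply: (vspan_Z ord0); exact: vspan_iter.
have sw j : vspan V v (w j).
  by apply: vspan_add; [exact: (vspan_Z ord0)|apply: vspan_V].
have bw j : b j = iter j.+3 V (w j).
  have bj : b j = j.+2%:R *: iter j.+3 V p - iter j.+2 V (b j) by rewrite -bE
    addrK.
  rewrite {1}bj [in iter j.+2 V (b j)]bj (linB _ _ (iter_lin j.+2)).
  rewrite (linZ _ _ (iter_lin j.+2)) /w (linD _ _ (iter_lin j.+3)).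
  rewrite (linZ _ _ (iter_lin j.+3)); congr (_ + _).
  rewrite /q (linN _ V_lin) (linN _ (iter_lin j.+3)); congr (- _).
  rewrite -iterSr (linB _ _ (iter_lin j.+4)) (linZ _ _ (iter_lin j.+4)).
  rewrite -!iterD (_ : (j.+2 + j.+3)%N = (j.+4 + j.+1)%N); last lia.
  by rewrite (_ : (j.+2 + j.+2)%N = (j.+4 + j)%N); last lia.
have /rV0Pn[j1 lj1] := l0.
(* The term of lowest order: after cancelling V^(j2+3), it alone contributes a multiple of [p], and
   everything else lies in the image of [V]. *)
have [j2 lj2 j2min] := @arg_minnP _ j1 (fun j => l 0 j != 0) (fun j =>
  j : nat) lj1.
pose z j := if j == j2 then q j else iter (j - j2).-1 V (w j).
have sz j : vspan V v (z j) by rewrite /z; case: ifP => _ //; exact: vspan_iter.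
pose Z := \sum_j l 0 j *: z j.
have sZ : vspan V v Z.
  by apply: (vspan_sum ord0) => j _; exact: (vspan_Z ord0).
have lj i : l 0 i != 0 -> i != j2 -> (j2 < i)%N.
  by move=> li ij; rewrite ltn_neqAle (j2min _ li) andbT eq_sym.
have zE j : l 0 j *: iter (j - j2) V (w j) =
    l 0 j *: (if j == j2 then j2.+2%:R *: p else 0) + V (l 0 j *: z j).
  rewrite (linZ _ _ V_lin) -scalerDr; have [->|lj0] := eqVneq (l 0 j) 0.
    by rewrite !scale0r.
  rewrite /z; congr (_ *: _); case: eqVneq => [->|ij]; first by rewrite subnn.
  by have := lj _ lj0 ij => ji; rewrite add0r -iterS prednK// subn_gt0.
have sum0 : \sum_j l 0 j *: iter (j - j2) V (w j) = 0.
  apply: (@iter_inj j2.+3); rewrite (lin_sum _ _ (iter_lin _)) -[RHS]lb.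
  apply: eq_bigr => j _; have [->|lj0] := eqVneq (l 0 j) 0;
    first by rewrite !scale0r.
  rewrite bw -iterD (_ : (j2.+3 + (j - j2))%N = j.+3)//.
  by have := j2min _ lj0 => /=; lia.
have pZ : (l 0 j2 * j2.+2%:R) *: p + V Z = 0.
  rewrite -sum0 (eq_bigr _ (fun j _ => zE j)) big_split /=; congr (_ + _).
    rewrite (bigD1 j2)//= eqxx scalerA big1 ?addr0// => j /negPf ->.
    by rewrite scaler0.
  rewrite /Z; elim/big_rec2: _ => [|j y1 y2 _ <-]; first exact: lin0.
  by rewrite (linD _ _ V_lin).
have lp : l 0 j2 * j2.+2%:R != 0 by rewrite mulf_neq0// pnatr_eq0.
have v0 : v ord0 = p by rewrite /v unlift_none.
have vS j : v (lift ord0 j) = b j by rewrite /v liftK.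
(* The module is generated by [p] and the [b j]; each [b j] is V of V^(j+2) (w j), and [p] is V of a
   multiple of [Z]. *)
rewrite -v0; apply: nakayama => i; case: (unliftP ord0 i) => [j ->|->].
  by exists (iter j.+2 V (w j)); [exact: vspan_iter|rewrite vS; exact: bw].
exists (- (l 0 j2 * j2.+2%:R)^-1 *: Z); first exact: (vspan_Z ord0).
move/eqP: pZ; rewrite addrC addr_eq0 => /eqP pZ.
by rewrite (linZ _ _ V_lin) pZ v0 scaleNr scalerN opprK scalerA mulVf// scale1r.
Qed.

(** * Weakly supercyclic tuples of multipliers *)

Section Tuple.
Context (n : nat) (T : 'I_n -> X -> X).
Hypothesis multT : forall j, multiplier (T j).

Let injective0 S := forall u, S u = 0 -> u = 0.

(** Injectivity of [Q] is recorded because the test vectors are chosen for [Q x], which must be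
    nonzero. *)
Lemma common_multiple (l : seq 'I_n) : exists Q, [/\ multiplier Q,
  injective0 Q &
  forall j, j \in l -> injective0 (T j) ->
    exists2 P, multiplier P & forall u, Q u = T j (P u)].
Proof.
elim: l => [|i l [Q [mQ iQ QP]]]; first by exists id; split => //;
  exact: multiplier_id.
have [iT|niT] := pselect (injective0 (T i)); last first.
  exists Q; split=> // j; rewrite inE => /orP[/eqP -> /niT//|]; exact: QP.
exists (fun u => T i (Q u)); split.
- exact: multiplier_comp.
- by move=> u /iT /iQ.
- move=> j; rewrite inE => /orP[/eqP -> _|jl iTj]; first by exists Q.
  have [P mP PE] := QP j jl iTj; exists (fun u => T i (P u)).
    exact: multiplier_comp.
  by move=> u; rewrite PE multiplier_comm.
Qed.

(* For [S = T_1 ^ m_1 \o ... \o T_n ^ m_n] the derivation rule gives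
   [brac S = sum_j m_j brac T_j S / T_j]; multiplying by a common multiple [Q]
   of the injective [T_j] removes the division. *)
Lemma semigroup_dichotomy Q (P : 'I_n -> X -> X) (g : 'I_n -> X) :
  multiplier Q -> (forall j, multiplier (P j)) ->
  (forall j, (g j != 0 /\ T j (g j) = 0) \/ (forall u, Q u = T j (P j u))) ->
  forall S, generated_semigroup T S -> multiplier S /\
    ((exists2 j, g j != 0 & S (g j) = 0) \/
     exists c : 'I_n -> K, forall u,
       Q (brac S u) = \sum_j c j *: brac (T j) (P j (S u))).
Proof.
move=> mQ mP gP; apply: smallest_sub.
- move=> S1 S2 [m1 h1] [m2 h2]; split; first exact: multiplier_comp.
  have [l1 _ _] := m1; have [lQ _ _] := mQ.
  case: h2 => [[j gj S2j]|[c2 h2]]; first by left; exists j => //=;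
    rewrite S2j lin0.
  case: h1 => [[j gj S1j]|[c1 h1]].
    by left; exists j => //=; rewrite multiplier_comm// S1j lin0//; case: m2.
  (* Exponents add under composition because [brac] satisfies the product rule. *)
  right; exists (fun j => c1 j + c2 j) => u.
  have -> : brac (S1 \o S2) u = brac S1 (S2 u) + S1 (brac S2 u).
    by rewrite /brac /= (linB _ _ l1) addrA subrK.
  rewrite (linD _ _ lQ) h1 (multiplier_comm (brac S2 u) mQ m1) h2 (lin_sum _ _
    l1) -big_split /=.
  apply: eq_bigr => j _; rewrite scalerDl; congr (_ + _ *: _).
  have mB := multiplier_brac (multT j).
  by rewrite (multiplier_comm _ m1 mB) (multiplier_comm _ m1 (mP j)).
- move=> _ [j _ <-]; split=> //.
  case: (gP j) => [[gj Tj]|Qj]; [by left; exists j|right].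
  exists (fun i => (i == j)%:R) => u; rewrite (bigD1 j)//= eqxx scale1r.
  rewrite big1 ?addr0 => [|i /negPf ->]; last by rewrite scale0r.
  have mB := multiplier_brac (multT j).
  rewrite Qj (multiplier_comm _ (mP j) mB) (multiplier_comm _ (multT j) mB).
  by rewrite (multiplier_comm _ (multT j) (mP j)).
Qed.

Lemma weak_functional_continuous (phi : X -> K^o) :
  (forall a u v, phi (a *: u + v) = a * phi u + phi v) ->
  (exists2 M : K, 0 <= M & forall u, `|phi u| <= M * `|u|) ->
  continuous (phi : weak X -> K^o).
Proof.
move=> lphi [M M0 phiM].
pose pf := GRing.isLinear.Build K X K^o *:%R phi lphi.
pose f : {linear X -> K^o} := HB.pack phi pf.
have cf : continuous f.
  apply: bounded_linear_continuous; apply/linear_boundedP.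
  exists M; split; first exact: ger0_real.
  by move=> r Mr x; apply: le_trans (phiM x) _; rewrite ler_wpM2r// ltW.
exact: (@weak_continuous K X (exist _ f cf)).
Qed.

Lemma index_inhabited : exists s, C s one one != 0.
Proof.
apply: contrapT => /forallNP H; move/eqP: one_neq0; apply; apply: C_one => s.
by apply/eqP; apply: contraT => /H.
Qed.

Lemma C_bdr s v : exists2 M : K, 0 <= M & forall u, `|C s v u| <= M * `|u|.
Proof. by have [M M0 h] := C_bd s v; exists M => // u; rewrite C_sym. Qed.

Theorem multiplier_tuple_not_weakly_supercyclic : ~ weakly_supercyclic T.
Proof.
move=> [x dx].
have [s0 s0P] := index_inhabited.
have x0 : x != 0.
  apply/eqP => x0.
  (* The orbit of 0 is {0}, which misses this nonempty weakly open set. *)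
  pose O : set (weak X) := [set y | C s0 one y != 0].
  have oO : open O.
    apply: (@open_neq0 K (weak X) (C s0 one));
      apply: weak_functional_continuous; last exact: C_bdr.
    by move=> a u v; exact: C_linr.
  have [|y [Oy [w _ [S ST yE]]]] := dx O _ oO; first by exists one.
  have [lS _ _] : multiplier S.
    by apply: (smallest_sub _ _ ST) => [S1 S2|_ [j _ <-]//];
      exact: multiplier_comp.
  by move: Oy; rewrite /O /= -yE x0 (lin0 lS) scaler0 C_sym C0l eqxx.
have [Q [mQ iQ QP]] := common_multiple (enum 'I_n).
(* [g j] also serves as a flag: it is 0 exactly when [T j] is injective, so products over [g j != 0]
   see only the others. *)
have /choice[g gP] : forall j, exists g,
  (g != 0 /\ T j g = 0) \/ (g = 0 /\ injective0 (T j)).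
  move=> j; have [iT|/existsNP[g /not_implyP[Tg /eqP g0]]] :=
    pselect (injective0 (T j)).
    by exists 0; right.
  by exists g; left.
have /choice[P PP] : forall j, exists P, multiplier P /\
    (injective0 (T j) -> forall u, Q u = T j (P u)).
  move=> j; have [iT|niT] := pselect (injective0 (T j)); last first.
    by exists id; split=> //; exact: multiplier_id.
  by have [P mP QE] := QP j (mem_enum _ _) iT; exists P.
have dich := @semigroup_dichotomy Q P g mQ (fun j => (PP j).1).
have {}dich S : generated_semigroup T S -> multiplier S /\
    ((exists2 j, g j != 0 & S (g j) = 0) \/
     exists c : 'I_n -> K, forall u,
       Q (brac S u) = \sum_j c j *: brac (T j) (P j (S u))).
  by apply: dich => j; case: (gP j) => [|[_ iT]]; [left|right; exact: (PP j).2].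
(* Generators of the space E of the overview; they depend on [x] but not on the orbit element. *)
pose e (i : 'I_n.+1) := if unlift ord0 i is Some j then brac (T j) (P j x) else
  Q (D x).
have [r [f [frf spf]]] := free_family e.
have p0 : Q x != 0 by apply: contra_neq x0 => /iQ.
have [m mP] := test_independent f p0.
pose F (i : 'I_r.+1) s y := if unlift ord0 i is Some i' then C s (f i') y else
  C s (Q x) (D y).
have sumF (c : 'I_r.+1 -> K) s y : \sum_i c i * F i s y =
    c ord0 * C s (Q x) (D y) + C s (\sum_i c (lift ord0 i) *: f i) y.
  rewrite big_ord_recl /F unlift_none C_suml; congr (_ + _).
  by apply: eq_bigr => i _; rewrite liftK.
have [s sP] : exists s : 'I_r.+1 ->
  I, \det (\matrix_(i, j) F i (s j) (test m)) != 0.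
  (* Row 0 is independent of the others by the choice of [m]; the others are independent because
     multiplication by [test m] is injective and [f] is free. *)
  apply: (@free_det_neq0 K I r.+1 (fun i s => F i s (test m))) => c c0.
  have cz : c ord0 = 0.
    apply/eqP; apply: contraT => c00.
    have [s /negP[]] := mP (fun i => - (c ord0)^-1 * c (lift ord0 i)).
    have := c0 s; rewrite sumF => /eqP; rewrite addr_eq0 => /eqP H.
    apply/eqP; apply: (mulfI c00); rewrite H C_suml mulr_sumr -sumrN.
    by apply: eq_bigr => i _; rewrite !mulrA mulrN mulfV// !mulN1r mulNr.
  have : \sum_i c (lift ord0 i) *: f i = 0.
    by apply: (@C_test_inj m) => s; have := c0 s; rewrite sumF cz mul0r add0r.
  by move=> /frf H i; case: (unliftP ord0 i) => [i' ->|->//]; exact: H.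
have /choice[t tP] : forall j, exists t, g j != 0 -> C t (g j) (test m) != 0.
  move=> j; apply: contrapT => /forallNP H.
  have [gj|/negPn/eqP gj] := boolP (g j != 0); last first.
    by apply: (H s0); rewrite gj eqxx.
  move/eqP: (gj); apply; apply: (@C_test_inj m) => t; apply/eqP;
    apply: contraT => Ct.
  by case: (H t).
(* [h] is weakly continuous, nonzero at [test m], and zero on the orbit. *)
pose M (y : weak X) : 'M[K^o]_r.+1 := \matrix_(i, j) F i (s j) y.
pose h (y : weak X) : K^o := \det (M y) *
  \prod_(j | g j != 0) C (t j) (g j) y.
have ch : continuous h.
  move=> y; apply: cvgM; first exact: nbhs_filter.
    apply: (@cvg_det K (weak X) (nbhs y) (nbhs_filter y) r.+1 M (M y)) => i j.
    rewrite mxE; under eq_fun do rewrite mxE.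
    rewrite /F; case: (unlift ord0 i) => [i'|];
      apply: weak_functional_continuous.
    - by move=> a u v; exact: C_linr.
    - exact: C_bdr.
    - by move=> a u v; rewrite D_lin C_linr.
    - have [B B0 BP] := C_brM_bd (s j) (Q x) D_bd.
      by exists B => // u; rewrite C_sym.
  apply: cvg_big => [||j _]; [exact: mul_continuous|exact: nbhs_filter|].
  apply: weak_functional_continuous; last exact: C_bdr.
  by move=> a u v; exact: C_linr.
pose O : set (weak X) := [set y | h y != 0].
have oO : open O.
  exact: open_neq0.
have [|y [Oy [w _ [S ST yE]]]] := dx O _ oO.
  exists (test m); rewrite /O /= /h mulf_neq0//.
  by rewrite prodf_seq_neq0; apply/allP => j _; apply/implyP; exact: tP.
have [mS SP] := dich S ST; have [lS _ _] := mS.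
move: Oy; rewrite /O /= -yE => /eqP; apply; rewrite /h.
case: SP => [[j gj Sgj]|[c cP]].
  rewrite (bigD1 j)//= (_ : C (t j) (g j) (w *: S x) = 0) ?mul0r ?mulr0//.
  by rewrite C_sym C_Zl (multiplier_C _ _ _ mS) Sgj C_sym C0l mulr0.
have [lQ _ _] := mQ.
have sumE : \sum_i (if unlift ord0 i is Some j then c j else 1) *: e i =
    Q (D x) + \sum_j c j *: brac (T j) (P j x).
  rewrite big_ord_recl unlift_none scale1r /e unlift_none; congr (_ + _).
  by apply: eq_bigr => j _; rewrite liftK.
(* The identity a * Dy = E-element * y of the overview, read through the forms: [S] is moved off [x]
   onto the E-element and back. *)
have rel s' : C s' (Q x) (D (w *: S x)) =
    C s' (\sum_i (if unlift ord0 i is Some j then c j else 1) *: e i) (w *: S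
      x).
  rewrite (multiplier_C _ _ _ mQ) (linZ _ _ D_lin) (linZ _ _ lQ).
  have -> : Q (D (S x)) = S (Q (D x)) + \sum_j c j *: S (brac (T j) (P j x)).
    have -> : D (S x) = S (D x) + brac S x by rewrite /brac addrC subrK.
    rewrite (linD _ _ lQ) (multiplier_comm _ mQ mS) cP; congr (_ + _).
    apply: eq_bigr => j _; congr (_ *: _).
    rewrite -(multiplier_comm _ mS (PP j).1).
    by rewrite -(multiplier_comm _ mS (multiplier_brac (multT j))).
  rewrite sumE -(lin_sum _ _ lS) -(linD _ _ lS) -(linZ _ _ lS) -(multiplier_C _
    _ _ mS).
  by rewrite C_sym C_Zl [in RHS]C_sym C_Zl; congr (_ * _); exact: C_sym.
have [d dE] := spf (fun i => if unlift ord0 i is Some j then c j else 1).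
suff /eqP -> : \det (M (w *: S x)) == 0 by rewrite mul0r.
(* The relation is a kernel vector of the matrix; the entry -1 at row 0 keeps it nonzero. *)
apply/det0P; exists (\row_i (if unlift ord0 i is Some i' then d i' else -1)).
  by apply/eqP => /rowP/(_ ord0); rewrite !mxE unlift_none => /eqP;
    rewrite oppr_eq0 oner_eq0.
apply/rowP => j; rewrite !mxE.
transitivity (\sum_i (if unlift ord0 i is Some i' then d i' else -1) * F i (s
  j) (w *: S x)).
  by apply: eq_bigr => i _; rewrite !mxE.
have sumE2 : \sum_i (if unlift ord0 (lift ord0 i) is Some i' then d i' else -1)
  *: f i =
    \sum_i d i *: f i by apply: eq_bigr => i _; rewrite liftK.
rewrite sumF unlift_none rel dE mulN1r sumE2.
by rewrite addNr.
Qed.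

End Tuple.

End VolterraAlgebra.

Lemma continuous_bounded (K : numFieldType) (X : normedModType K) (f : {linear
  X -> X}) :
  continuous f -> bounded f.
Proof.
move=> cf; have /linear_boundedP := continuous_linear_bounded 0 (cf 0).
by move=> /pinfty_ex_gt0[M M0 fM]; exists M => //; exact: ltW.
Qed.

Unset Implicit Arguments.
Theorem corollary1p3 (R : realType) (k : scalar_kind) (n : nat)
    (T : 'I_n -> {linear L1 k (leb01 R) -> L1 k (leb01 R)})
    (Tcontinuous : forall j, continuous (T j))
    (Tcommute : forall i j f, T i (T j f) = T j (T i f))
    (Tvolterra : forall j f, T j (volterra f) = volterra (T j f)) :
  ~ weakly_supercyclic (fun j => T j : L1 k (leb01 R) -> L1 k (leb01 R)).
Proof.
(* The functionals are indexed by [R], the upper limits of the primitives of convolutions. *)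
apply: (@multiplier_tuple_not_weakly_supercyclic _ _ R (@volterra R k)
  (@mulX01 R k) (oneL1 R k) (@convL1 R k)).
- exact: volterra_lin.
- exact: mulX01_lin.
- by exists 2%:R => // u; exact: mulX01_bound.
- exact: convL1_linl.
- exact: convL1_sym.
- exact: convL1_V.
- by move=> s v; exists (4%:R * `|v|) => [|u];
    [rewrite mulr_ge0|rewrite mulrAC; exact: convL1_bound].
- exact: convL1_oneL1_inj.
- exact: volterra_inj.
- exact: mulX01_V.
- exact: mulX01_oneL1.
- exact: oneL1_neq0.
- exact: oneL1_dense.
- exact: volterra_nakayama.
- move=> j; split.
  + by move=> a u v; rewrite linearP.
  + exact: continuous_bounded.
  + exact: Tvolterra.
Qed.
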